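(* Let $A,B,R,C_1,C_2,C_3$ be finite-dimensional quantum systems, $C=C_1C_2C_3$, let $A''$ be a duplicate of $A$, $B'$ a duplicate of $B$, and $C',C''$ duplicates of $C$. Let $A_2$ be a system with $d_{A_2}=d_{C_2}$ and $B_1$ a system with $d_{B_1}=d_{C_1}$, and let $\Phi_{C_2A_2}$ and $\Phi_{C_1B_1}$ be (the density operators of) maximally entangled pure states on $C_2A_2$ and $C_1B_1$. Let $|\varphi_{CABR}\rangle$ be any pure state and let $|\hat\varphi_{CABR}\rangle$, $|\check\varphi_{CABR}\rangle$ be any two pure states (reference states) on $CABR$. Define $$\gamma_1=2\|\varphi_{CABR}-\hat\varphi_{CABR}\|_1,\qquad \gamma_2=2\|\varphi_{CABR}-\check\varphi_{CABR}\|_1,$$ $$\eta_1=2\left(\frac{2\,d_C\,d_{BR}\,\mathrm{Tr}\big[(\hat\varphi_{CBR})^2\big]}{d_{C_1C_3}^2}\right)^{1/4},\qquad \eta_2=2\left(\frac{2\,d_C\,d_{AR}\,\mathrm{Tr}\big[(\check\varphi_{CAR})^2\big]}{d_{C_2C_3}^2}\right)^{1/4},$$ and $\Delta_i=\gamma_i+\eta_i$ for $i=1,2$. Let $$\Upsilon_{initial}=\Phi_{C_2A_2}\otimes\varphi_{C''A''BR},\qquad \Upsilon_{final}=\Phi_{C_1B_1}\otimes\varphi_{C'AB'R},$$ where $\varphi_{C''A''BR}$ and $\varphi_{C'AB'R}$ are the same pure state as $\varphi_{CABR}$, carried by the indicated duplicate systems. Then there exist isometries $V:C_2C_3B\to B_1C'B'$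 and $W:C_1C_3A\to A_2C''A''$ such that $$\big\|(V\circ W^{-1})\cdot\Upsilon_{initial}-\Upsilon_{final}\big\|_1\le\Delta_1+\Delta_2,$$ $$\big\|(W\circ V^{-1})\cdot\Upsilon_{final}-\Upsilon_{initial}\big\|_1\le\Delta_1+\Delta_2.$$
   Context: All systems are finite-dimensional complex Hilbert spaces; juxtaposition of systems denotes tensor product, and $d_X$ is the dimension of $X$ (so $d_{XY}=d_Xd_Y$). For a pure state $|\varphi\rangle$, $\varphi=|\varphi\rangle\langle\varphi|$. Omitting system labels denotes the reduced state (partial trace), e.g. $\hat\varphi_{CBR}=\mathrm{Tr}_A\,\hat\varphi_{CABR}$ and $\check\varphi_{CAR}=\mathrm{Tr}_B\,\check\varphi_{CABR}$. A duplicate of a system is an isomorphic copy of it with a fixed identification. The trace norm is $\|\rho\|_1=\mathrm{Tr}\sqrt{\rho^\dagger\rho}$. For an operator $T$, $T\cdot\rho=T\rho T^\dagger$; operators act as the identity on systems not mentioned. For an isometry $W$, $W^{-1}$ denotes the adjoint $W^\dagger$ (the inverse of $W$ on its range, zero on the orthogonal complement of the range), and likewise for $V^{-1}$. Thus $V\circ W^{-1}$ maps $A_2C''A''\otimes C_2BR$ first to $C_1C_3A\otimes C_2BR$ and then to $C_1A\otimes B_1C'B'\otimes R$. *)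

(* Defs.v *)
From HB Require Import structures.
From mathcomp Require Import all_boot all_order all_algebra.
From mathcomp Require Import spectral sesquilinear.
From mathcomp Require Import complex.
From mathcomp Require Import reals.

Set Implicit Arguments.
Unset Strict Implicit.
Unset Printing Implicit Defensive.

Import Order.TTheory GRing.Theory Num.Theory Num.Def.
Local Open Scope ring_scope.
Local Open Scope sesquilinear_scope.

(* A quantum system is a finite type X labelling an orthonormal basis of its  *)
(* Hilbert space F^X, so that d_X = #|X|, the product type X * Y is the       *)
(* tensor product of X and Y, and a duplicate of X is another occurrence of   *)
(* the type X. Operators are matrices in these bases, with basis labels       *)
(* turned into matrix indices by enum_rank. The scalars F will be the         *)
(* complex numbers K[i] with K : realType. Traces, trace norms and roots live *)
(* in F, where x <= y means that y - x is a nonnegative real.                 *)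

Notation ket F X := 'cV[F]_(#|(X%type : finType)|).
(* op F X Y: the linear operators from X to Y. *)
Notation op F X Y :=
  'M[F]_(#|(Y%type : finType)|, #|(X%type : finType)|).

Section QuantumSystems.
Variable F : numClosedFieldType.
Implicit Types X Y Z : finType.

Definition mkop X Y (f : Y -> X -> F) : op F X Y :=
  \matrix_(i, j) f (enum_val i) (enum_val j).

Definition entry X Y (M : op F X Y) (y : Y) (x : X) : F :=
  M (enum_rank y) (enum_rank x).

Definition tensv X Y (u : ket F X) (v : ket F Y) : ket F (X * Y)%type :=
  \col_i (u (enum_rank (enum_val i).1) 0 * v (enum_rank (enum_val i).2) 0).

Definition tens X X' Y Y' (S : op F X X') (T : op F Y Y') :
    op F (X * Y)%type (X' * Y')%type :=
  mkop (fun p q => entry S p.1 q.1 * entry T p.2 q.2).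

Definition idop X : op F X X := 1%:M.

(* For a bijection f, the unitary |f y> |-> |y>. It is used to reorder and    *)
(* regroup tensor factors.                                                    *)
Definition wire X Y (f : Y -> X) : op F X Y :=
  mkop (fun y x => (x == f y)%:R).

Definition conj_by X Y (T : op F X Y) (rho : op F X X) : op F Y Y :=
  T *m rho *m T ^t*.

(* The partial trace over Y. *)
Definition ptrace2 X Y (rho : op F (X * Y)%type (X * Y)%type) : op F X X :=
  mkop (fun x x' => \sum_(y : Y) entry rho (x, y) (x', y)).

Definition braket X (u v : ket F X) : F := \tr (u ^t* *m v).

Definition pure X (u : ket F X) : Prop := braket u u = 1.

Definition proj X (u : ket F X) : op F X X := u *m u ^t*.

Definition orthonormal_fam I X (e : I -> ket F X) : Prop :=
  (forall i, braket (e i) (e i) = 1) /\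
  (forall i j, i <> j -> braket (e i) (e j) = 0).

(* When #|X| = #|Y| the two orthonormal families indexed by X are orthonormal *)
(* bases of the two systems.                                                  *)
Definition max_entangled X Y (Phi : ket F (X * Y)%type) : Prop :=
  exists (e : X -> ket F X) (f : X -> ket F Y),
    [/\ orthonormal_fam e, orthonormal_fam f &
        Phi = (sqrtC #|X|%:R)^-1 *: \sum_(i : X) tensv (e i) (f i)].

Definition isometry_op X Y (T : op F X Y) : Prop := T ^t* *m T = 1%:M.

(* The square root of a positive semidefinite matrix, by functional calculus. *)
Definition sqrtmx n (M : 'M[F]_n) : 'M[F]_n :=
  invmx (spectralmx M) *m diag_mx (map_mx sqrtC (spectral_diag M))
    *m spectralmx M.

Definition trnorm n (M : 'M[F]_n) : F := \tr (sqrtmx (M ^t* *m M)).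

End QuantumSystems.

Section Redistribution.
Variable F : numClosedFieldType.

Definition reduced_CBR (C A B R : finType) (phi : ket F (C * A * B * R)%type) :
    op F (C * B * R)%type (C * B * R)%type :=
  ptrace2 (conj_by
    (wire F (fun p : C * B * R * A =>
       let: (c, b, r, a) := p in (c, a, b, r))) (proj phi)).

Definition reduced_CAR (C A B R : finType) (phi : ket F (C * A * B * R)%type) :
    op F (C * A * R)%type (C * A * R)%type :=
  ptrace2 (conj_by
    (wire F (fun p : C * A * R * B =>
       let: (c, a, r, b) := p in (c, a, b, r))) (proj phi)).

(* Phi_{C2 A2} (x) phi_{C'' A'' B R}, factors ordered (A2 C'' A'') (C2 B R). *)
Definition Upsilon_initial (C2 A2 C A B R : finType)
    (Phi2 : ket F (C2 * A2)%type) (phi : ket F (C * A * B * R)%type) :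
    op F (A2 * C * A * (C2 * B * R))%type (A2 * C * A * (C2 * B * R))%type :=
  conj_by
    (wire F (fun p : A2 * C * A * (C2 * B * R) =>
       let: ((a2, c, a), (c2, b, r)) := p in ((c2, a2), (c, a, b, r))))
    (tens (proj Phi2) (proj phi)).

(* Phi_{C1 B1} (x) phi_{C' A B' R}, factors ordered (C1 A) (B1 C' B') R. *)
Definition Upsilon_final (C1 B1 C A B R : finType)
    (Phi1 : ket F (C1 * B1)%type) (phi : ket F (C * A * B * R)%type) :
    op F (C1 * A * (B1 * C * B) * R)%type (C1 * A * (B1 * C * B) * R)%type :=
  conj_by
    (wire F (fun p : C1 * A * (B1 * C * B) * R =>
       let: ((c1, a), (b1, c, b), r) := p in ((c1, b1), (c, a, b, r))))
    (tens (proj Phi1) (proj phi)).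

(* The canonical unitary (C1 C3 A) (C2 B R) -> (C1 A) (C2 C3 B) R. *)
Definition regroup (C1 C2 C3 A B R : finType) :
    op F (C1 * C3 * A * (C2 * B * R))%type (C1 * A * (C2 * C3 * B) * R)%type :=
  wire F (fun p : C1 * A * (C2 * C3 * B) * R =>
    let: ((c1, a), (c2, c3, b), r) := p in ((c1, c3, a), (c2, b, r))).

Definition V_Winv (C1 C2 C3 C A B R A2 B1 : finType)
    (V : op F (C2 * C3 * B)%type (B1 * C * B)%type)
    (W : op F (C1 * C3 * A)%type (A2 * C * A)%type) :
    op F (A2 * C * A * (C2 * B * R))%type (C1 * A * (B1 * C * B) * R)%type :=
  tens (tens (idop F (C1 * A)%type) V) (idop F R)
    *m regroup C1 C2 C3 A B R
    *m tens (W ^t*) (idop F (C2 * B * R)%type).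

Definition W_Vinv (C1 C2 C3 C A B R A2 B1 : finType)
    (V : op F (C2 * C3 * B)%type (B1 * C * B)%type)
    (W : op F (C1 * C3 * A)%type (A2 * C * A)%type) :
    op F (C1 * A * (B1 * C * B) * R)%type (A2 * C * A * (C2 * B * R))%type :=
  tens W (idop F (C2 * B * R)%type)
    *m (regroup C1 C2 C3 A B R) ^t*
    *m tens (tens (idop F (C1 * A)%type) (V ^t*)) (idop F R).

End Redistribution.

Arguments V_Winv {F C1 C2 C3 C A B} R {A2 B1} V W.
Arguments W_Vinv {F C1 C2 C3 C A B} R {A2 B1} V W.

(* Main.v *)
Require Import Defs.
From HB Require Import structures.
From mathcomp Require Import all_boot all_order all_algebra.
From mathcomp Require Import fingroup perm cyclic separable cyclotomic.
From mathcomp Require Import spectral sesquilinear.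
From mathcomp Require Import complex.
From mathcomp Require Import reals.
From mathcomp Require Import ring.

Set Implicit Arguments.
Unset Strict Implicit.
Unset Printing Implicit Defensive.

Import Order.TTheory GRing.Theory Num.Theory.
Local Open Scope ring_scope.
Local Open Scope sesquilinear_scope.

(* Let U be a unitary on C. If U makes C2 nearly maximally mixed and
   uncorrelated with BR in the reference state phihat, then Uhlmann's theorem
   gives an isometry W on C1 C3 A with W U phihat close to Phi_{C2 A2} (x)
   phihat, and likewise a decoupling of C1 from AR in phicheck gives V. Through
   U phi, the map V o W^-1 then takes Upsilon_initial close to Upsilon_final, up
   to the distances of phi to the reference states. One U must do both, so the
   two errors are averaged over the same random unitary.

   The average is not over the Haar measure but over the finite ensemble
   Z P H Z', with Z, Z' random diagonal matrices of powers of i, P a random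
   permutation matrix and H the discrete Fourier matrix. For A = U M U*, its
   mean of sum_{k,k'} |sum_e A_{(k,e),(k',e)}|^2 is at most
   |M|_2^2 / d_E + |tr M|^2 / d_K, which is also the bound that one uses for
   the Haar measure. *)

(** * Trace norm, polar decomposition and Uhlmann's theorem *)

(** Origin of the constants. Each decoupling error is divided by the bound on its mean; the two
    quotients together have mean at most 2, so some [U] keeps both at most 2. This is the 2 under
    the fourth root. Going from the Hilbert-Schmidt norm to the trace norm on [C2 B R] costs d_{C2
    BR} under a square root, and going from reduced states to purifications takes one more square
    root: hence the power 1/4. As d_{C2} = d_C / d_{C1 C3}, this gives the shape of [eta1]. The 2 in
    front comes from the trace distance 2 sqrt(1 - c^2) of unit kets with overlap c, the 2 in
    [gamma1] from replacing the reference state by phi in both states that are compared.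

    The decoupling estimate involves the unitary only through products of two entries and two
    conjugate entries. Finite sums over phases and permutations control these, so no integration
    over the unitary group enters. *)

Section Adjoint.
Variable F : numClosedFieldType.

Lemma adjM m n p (A : 'M[F]_(m, n)) (B : 'M_(n, p)) :
  (A *m B) ^t* = B ^t* *m A ^t*.
Proof. by rewrite trmx_mul map_mxM. Qed.

Lemma adjD m n (A B : 'M[F]_(m, n)) : (A + B) ^t* = A ^t* + B ^t*.
Proof. by rewrite linearD map_mxD. Qed.

Lemma adjB m n (A B : 'M[F]_(m, n)) : (A - B) ^t* = A ^t* - B ^t*.
Proof. by rewrite linearB map_mxB. Qed.

Lemma adjZ m n a (A : 'M[F]_(m, n)) : (a *: A) ^t* = a^* *: A ^t*.
Proof. by rewrite linearZ /= map_mxZ. Qed.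

Lemma adj1 n : (1%:M : 'M[F]_n) ^t* = 1%:M.
Proof. by rewrite trmx1 map_mx1. Qed.

Lemma adjE m n (A : 'M[F]_(m, n)) i j : A ^t* i j = (A j i)^*.
Proof. by rewrite !mxE. Qed.

Lemma mxtrace_adj n (A : 'M[F]_n) : \tr (A ^t*) = (\tr A)^*.
Proof. by rewrite rmorph_sum; apply: eq_bigr => i _; rewrite adjE. Qed.

(** The squared Hilbert-Schmidt norm. On kets it is convertible to [braket u u], so [pure u] reads
    [norm2sq u = 1]. *)
Definition norm2sq m n (A : 'M[F]_(m, n)) : F := \tr (A ^t* *m A).

Lemma norm2sqE m n (A : 'M[F]_(m, n)) :
  norm2sq A = \sum_i \sum_j `|A i j| ^+ 2.
Proof.
rewrite exchange_big; apply: eq_bigr => j _; rewrite mxE.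
by apply: eq_bigr => i _; rewrite adjE normCKC.
Qed.

Lemma norm2sq_ge0 m n (A : 'M[F]_(m, n)) : 0 <= norm2sq A.
Proof.
rewrite norm2sqE; apply: sumr_ge0 => i _; apply: sumr_ge0 => j _.
exact: exprn_ge0.
Qed.

Lemma norm2sq_eq0 m n (A : 'M[F]_(m, n)) : norm2sq A = 0 -> A = 0.
Proof.
rewrite norm2sqE => A0; apply/matrixP => i j; rewrite mxE.
have row_ge0 k : 0 <= \sum_j `|A k j| ^+ 2.
  by apply: sumr_ge0 => l _; apply: exprn_ge0.
have Ai := psumr_eq0P (fun k _ => row_ge0 k) A0 (i := i) isT.
have := psumr_eq0P (fun l _ => exprn_ge0 2 (normr_ge0 (A i l))) Ai (i := j) isT.
by move/eqP; rewrite expf_eq0 /= normr_eq0 => /eqP.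
Qed.

Lemma norm2sq_gt0 n (M : 'M[F]_n) : \tr M = 1 -> 0 < norm2sq M.
Proof.
move=> trM; rewrite lt_def norm2sq_ge0 andbT.
apply/eqP => /norm2sq_eq0 M0; move: trM; rewrite M0 mxtrace0 => /esym/eqP.
by rewrite oner_eq0.
Qed.

Lemma norm2sqZ m n a (A : 'M[F]_(m, n)) :
  norm2sq (a *: A) = `|a| ^+ 2 * norm2sq A.
Proof.
by rewrite /norm2sq adjZ -scalemxAl -scalemxAr scalerA mxtraceZ normCKC.
Qed.

Lemma norm2sq_isometry m n p (W : 'M[F]_(m, n)) (A : 'M_(n, p)) :
  W ^t* *m W = 1%:M -> norm2sq (W *m A) = norm2sq A.
Proof.
by move=> hW; rewrite /norm2sq adjM mulmxA -(mulmxA _ _ W) hW mulmx1.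
Qed.

Lemma isometryM p q r (V : 'M[F]_(p, q)) (W : 'M[F]_(q, r)) :
  V ^t* *m V = 1%:M -> W ^t* *m W = 1%:M -> (V *m W) ^t* *m (V *m W) = 1%:M.
Proof. by move=> VV WW; rewrite adjM mulmxA -(mulmxA _ _ V) VV mulmx1. Qed.

(** [norm2sq (a *: B - c *: A)] equals a (a b - |c|^2) and is nonnegative; a can be divided out
    unless [A = 0]. *)
Lemma mxtrace_CauchySchwarz m n (A B : 'M[F]_(m, n)) :
  `|\tr (A ^t* *m B)| ^+ 2 <= norm2sq A * norm2sq B.
Proof.
set a := norm2sq A; set b := norm2sq B; set c := \tr _.
have [/eqP a0|a_neq0] := boolP (a == 0).
  rewrite /c (norm2sq_eq0 a0) trmx0 map_mx0 mul0mx mxtrace0 normr0 a0 mul0r.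
  by rewrite expr0n.
have a_gt0 : 0 < a by rewrite lt_def a_neq0 norm2sq_ge0.
have acj : a^* = a by apply/CrealP/ger0_real/norm2sq_ge0.
have ccj : \tr (B ^t* *m A) = c^*.
  by rewrite -mxtrace_adj adjM trmxCK.
have : 0 <= norm2sq (a *: B - c *: A) by exact: norm2sq_ge0.
rewrite /norm2sq adjB !adjZ mulmxBl !mulmxBr -!scalemxAl -!scalemxAr !scalerA.
rewrite !raddfB /= !mxtraceZ -/a -/b -/c ccj acj normCK.
rewrite -[\tr (B ^t* *m B)]/b -[\tr (A ^t* *m A)]/a.
have -> : a * a * b - a * c * c^* + (- (c^* * a * c) - - (c^* * c * a))
   = a * (a * b - c * c^*) by ring.
by rewrite pmulr_rge0 // subr_ge0.
Qed.

Lemma mxtrace_CauchySchwarz_sqrt m n (A B : 'M[F]_(m, n)) :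
  `|\tr (A ^t* *m B)| <= sqrtC (norm2sq A * norm2sq B).
Proof.
rewrite -[leLHS]sqrCK //.
by rewrite ler_sqrtC ?qualifE /= ?mxtrace_CauchySchwarz ?exprn_ge0 //
  mulr_ge0 ?norm2sq_ge0.
Qed.

End Adjoint.

Section Polar.
Variable F : numClosedFieldType.

Lemma exists_orthogonal_unit m n (A : 'M[F]_(m, n)) : (m < n)%N ->
  exists u : 'cV_n, A *m u = 0 /\ u ^t* *m u = 1%:M.
Proof.
move=> lt_mn.
have /rowV0Pn[v] : kermx A^T != 0.
  rewrite -mxrank_eq0 mxrank_ker subn_eq0 -ltnNge mxrank_tr.
  exact: leq_ltn_trans (rank_leq_row A) lt_mn.
move=> /sub_kermxP vA0 v_neq0; pose a := norm2sq v^T.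
have a_neq0 : a != 0.
  apply: contra_neq v_neq0 => /norm2sq_eq0 vT0.
  by rewrite -[v]trmxK vT0 trmx0.
have a_ge0 : 0 <= a by exact: norm2sq_ge0.
exists ((sqrtC a)^-1 *: v^T); split.
  by rewrite -scalemxAr -[A]trmxK -trmx_mul vA0 trmx0 scaler0.
rewrite [LHS]mx11_scalar -trace_mx11 -[X in X%:M]/(norm2sq _) norm2sqZ.
rewrite -/a ger0_norm ?invr_ge0 ?sqrtC_ge0 // exprVn sqrtCK mulVf //.
Qed.

(** The columns outside [P] are arbitrary. They are replaced one at a time, by induction on their
    number. *)
Lemma extend_isometry m n (P : pred 'I_m) (Y : 'M[F]_(n, m)) : (m <= n)%N ->
  (forall i j, P i -> P j -> (Y ^t* *m Y) i j = (i == j)%:R) ->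
  exists U : 'M[F]_(n, m), U ^t* *m U = 1%:M /\ forall i, P i -> col i U = col i Y.
Proof.
move=> le_mn; elim: {P}_.+1 {-2}P (ltnSn #|predC P|) Y => // k IHk P leP Y Yortho.
have [/existsP[i nPi]|] := boolP [exists i, ~~ P i]; last first.
  rewrite negb_exists => /forallP allP; exists Y; split=> //.
  have {}allP i : P i by have := allP i; rewrite negbK.
  by apply/matrixP => i j; rewrite Yortho // !mxE.
case: m le_mn P Y leP Yortho i nPi IHk => [|m] le_mn P Y leP Yortho i nPi IHk.
  by have := ltn_ord i; rewrite ltn0.
(* Without row [i] there remain fewer conditions than dimensions. The vector [u] is orthogonal to
   all other columns, also to those still to be replaced. *)
have [u [Yu0 uu1]] := exists_orthogonal_unit (row' i (Y ^t*)) le_mn.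
pose Y' := \matrix_(k, l) if l == i then u k 0 else Y k l.
have colY' j : j != i -> col j Y' = col j Y.
  by move=> /negPf j_neq; apply/colP => l; rewrite !mxE j_neq.
have colY'i : col i Y' = u by apply/colP => l; rewrite !mxE eqxx.
have dotE (A B : 'M[F]_(n, m.+1)) j l :
    (A ^t* *m B) j l = ((col j A) ^t* *m col l B) 0 0.
  by rewrite !mxE; apply: eq_bigr => x _; rewrite !mxE.
have Yu j : j != i -> (col j Y) ^t* *m u = 0.
  rewrite eq_sym => /unlift_some[j' -> _].
  apply/matrixP => x y; rewrite !ord1 [RHS]mxE.
  have /matrixP/(_ j' 0) := Yu0; rewrite !mxE; apply: etrans.
  by apply: eq_bigr => z _; rewrite !mxE.
have uY j : j != i -> u ^t* *m col j Y = 0.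
  by move=> /Yu /(congr1 (fun M : 'M_1 => M ^t*)); rewrite adjM trmxCK trmx0 map_mx0.
have [|j l|U [UU UY']] := IHk (predU1 i P) _ Y'.
- rewrite -ltnS; apply: leq_trans leP; rewrite ltnS; apply: proper_card.
  apply/properP; split; last first.
    by exists i; rewrite unfold_in /= ?nPi // eqxx.
  by apply/subsetP => j; rewrite !unfold_in /= negb_or => /andP[].
- rewrite /= dotE; have [->|j_neq] := eqVneq j i => Pj.
    rewrite colY'i; have [->|l_neq] := eqVneq l i => Pl.
      by rewrite colY'i uu1 mxE.
    by rewrite colY' // uY // mxE.
  rewrite colY' //; have [->|l_neq] := eqVneq l i => Pl.
    by rewrite colY'i Yu // mxE (negPf j_neq).
  by rewrite colY' // -dotE Yortho.
exists U; split=> // j Pj; rewrite UY' /= ?Pj ?orbT // colY' //.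
by apply: contraTneq Pj => ->.
Qed.

(** Unfolds the functional calculus once: [sqrtmx] of a Gram matrix and the Gram matrix itself in
    one eigenbasis, with nonnegative [s]. *)
Lemma sqrtmx_gram m n (A : 'M[F]_(n, m)) :
  exists (V : 'M[F]_m) (s : 'rV[F]_m),
    [/\ V *m V ^t* = 1%:M, V ^t* *m V = 1%:M, forall i, 0 <= s 0 i,
        sqrtmx (A ^t* *m A) = V ^t* *m diag_mx s *m V &
        A ^t* *m A = V ^t* *m diag_mx (\row_i s 0 i ^+ 2) *m V].
Proof.
set M := A ^t* *m A; pose V := spectralmx M.
have V_unitary : V \is unitarymx by exact: spectral_unitarymx.
have VV : V *m V ^t* = 1%:M by exact/unitarymxP.
have VV' : V ^t* *m V = 1%:M by exact: mulmx1C.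
have invV : invmx V = V ^t* by exact: invmx_unitary.
have /orthomx_spectralP : M \is normalmx.
  by apply/normalmxP; rewrite /M !adjM trmxCK.
rewrite -/V invV => ME.
have diagE : diag_mx (spectral_diag M) = (A *m V ^t*) ^t* *m (A *m V ^t*).
  rewrite adjM trmxCK mulmxA -(mulmxA V) -/M [in RHS]ME.
  by rewrite !mulmxA VV mul1mx -mulmxA VV mulmx1.
have diag_ge0 i : 0 <= spectral_diag M 0 i.
  have /matrixP/(_ i i) := diagE; rewrite !mxE eqxx mulr1n => ->.
  by apply: sumr_ge0 => k _; rewrite adjE -normCKC exprn_ge0.
exists V, (map_mx sqrtC (spectral_diag M)); split=> //.
- by move=> i; rewrite mxE sqrtC_ge0.
- by rewrite /sqrtmx -/V invV.
- rewrite {1}ME; congr (_ *m diag_mx _ *m _).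
  by apply/rowP => i; rewrite !mxE sqrtCK.
Qed.

(** In the eigenbasis of the Gram matrix, the columns of [A] become orthogonal of lengths [s 0 i].
    Normalizing the nonzero ones and completing them gives [U]; where [s 0 i = 0] the column
    vanishes and any completion will do. *)
Lemma polar_isometry m n (A : 'M[F]_(n, m)) : (m <= n)%N ->
  exists U : 'M[F]_(n, m),
    U ^t* *m U = 1%:M /\ U ^t* *m A = sqrtmx (A ^t* *m A).
Proof.
move=> le_mn; have [V [s [VV VV' s_ge0 -> AE]]] := sqrtmx_gram A.
have [B defB] : exists B, B = A *m V ^t* by exists (A *m V ^t*).
have BE : B ^t* *m B = diag_mx (\row_i s 0 i ^+ 2).
  rewrite defB adjM trmxCK mulmxA -(mulmxA V) AE.
  by rewrite !mulmxA VV mul1mx -mulmxA VV mulmx1.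
pose P := [pred i | s 0 i != 0].
(* Where [s 0 i = 0] the quotient is 0 by convention; these columns lie outside [P] and get
   replaced. *)
pose Y := \matrix_(k, i) (B k i / s 0 i).
have conj_s i : (s 0 i)^* = s 0 i by apply/CrealP/ger0_real.
have YE i j : (Y ^t* *m Y) i j = (B ^t* *m B) i j / (s 0 i * s 0 j).
  rewrite [LHS]mxE [in RHS]mxE mulr_suml; apply: eq_bigr => k _.
  rewrite !adjE !mxE rmorphM fmorphV /= conj_s invfM; ring.
have [i j si sj|U [UU UY]] := @extend_isometry m n P Y le_mn.
  rewrite YE BE !mxE; case: eqVneq => [->|_]; last by rewrite mulr0n mul0r.
  by rewrite mulr1n -expr2 divff // expf_neq0.
exists (U *m V); split.
  by rewrite adjM mulmxA -(mulmxA _ (U ^t*)) UU mulmx1.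
suff UB : U ^t* *m B = diag_mx s.
  by rewrite adjM -UB defB !mulmxA -!mulmxA VV' mulmx1.
apply/matrixP => i j; rewrite [RHS]mxE.
have [sj|sj] := eqVneq (s 0 j) 0.
  suff Bj k : B k j = 0.
    rewrite mxE big1 => [|k _]; last by rewrite Bj mulr0.
    by case: eqVneq => [->|//]; rewrite sj.
  have /matrixP/(_ j j) := BE; rewrite mxE [in RHS]mxE mxE sj expr0n eqxx mulr1n => B0.
  have term_ge0 l : 0 <= B ^t* j l * B l j.
    by rewrite adjE -normCKC exprn_ge0.
  have /eqP := psumr_eq0P (fun l _ => term_ge0 l) B0 (i := k) isT.
  by rewrite adjE -normCKC expf_eq0 /= normr_eq0 => /eqP.
have Bj k : B k j = U k j * s 0 j.
  have /colP/(_ k) := UY j sj; rewrite !mxE => ->.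
  by rewrite divfK.
have -> : (U ^t* *m B) i j = (U ^t* *m U) i j * s 0 j.
  by rewrite !mxE mulr_suml; apply: eq_bigr => k _; rewrite Bj mulrA.
by rewrite UU mxE; case: eqVneq => [->|_]; rewrite ?mul1r ?mul0r.
Qed.

End Polar.

Section TraceNorm.
Variable F : numClosedFieldType.

(** Operator norm at most 1. This class contains the isometries and is closed under products and
    adjoints, hence it contains V o W^-1, which need not be an isometry. *)
Definition contraction m n (K : 'M[F]_(m, n)) : Prop :=
  forall v : 'cV_n, norm2sq (K *m v) <= norm2sq v.

Lemma isometry_contraction m n (W : 'M[F]_(m, n)) :
  W ^t* *m W = 1%:M -> contraction W.
Proof. by move=> hW v; rewrite norm2sq_isometry. Qed.

Lemma contractionM m n p (K : 'M[F]_(m, n)) (L : 'M_(n, p)) :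
  contraction K -> contraction L -> contraction (K *m L).
Proof. by move=> hK hL v; rewrite -mulmxA (le_trans (hK _)). Qed.

(** With w the image of v under the adjoint, |w|^2 is the inner product of v and K w. Cauchy-Schwarz
    gives |w|^4 <= |v|^2 |w|^2, and |w|^2 is divided out. *)
Lemma contraction_adj m n (K : 'M[F]_(m, n)) :
  contraction K -> contraction (K ^t*).
Proof.
move=> hK v; set w := K ^t* *m v; set a := norm2sq w.
have a_ge0 : 0 <= a by exact: norm2sq_ge0.
have [->|a_neq0] := eqVneq a 0; first exact: norm2sq_ge0.
have : a ^+ 2 <= norm2sq v * a.
  have := mxtrace_CauchySchwarz v (K *m w).
  rewrite mulmxA -[v ^t* *m K]trmxCK adjM trmxCK -/w -[\tr _]/a ger0_norm //.
  move=> /le_trans; apply; apply: ler_wpM2l; [exact: norm2sq_ge0|exact: hK].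
by rewrite expr2 ler_pM2r // lt_def a_neq0.
Qed.

Lemma contraction_diag_le1 n (K : 'M[F]_n) i : contraction K -> `|K i i| <= 1.
Proof.
move=> hK; pose e : 'cV[F]_n := delta_mx i 0.
have e1 : norm2sq e = 1.
  rewrite norm2sqE (bigD1 i) //= [X in _ + X]big1 ?addr0 => [|j /negPf j_neq].
    by rewrite big_ord1 mxE !eqxx normr1 expr1n.
  by rewrite big_ord1 mxE j_neq normr0 expr0n.
have -> : K i i = \tr (e ^t* *m (K *m e)).
  rewrite trace_mx11 /e -colE mxE (bigD1 i) //= big1 => [|j /negPf j_neq].
    by rewrite !mxE !eqxx rmorph1 mul1r addr0.
  by rewrite !mxE j_neq rmorph0 mul0r.
rewrite -(@ler_pXn2r _ 2) ?qualifE //= expr1n.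
apply: le_trans (mxtrace_CauchySchwarz _ _) _.
by rewrite e1 mul1r -e1; apply: hK.
Qed.

(** By the polar and spectral decompositions, the trace is a sum of [s 0 i] times diagonal entries
    of a contraction, which have modulus at most 1. *)
Lemma mxtrace_contraction_le n (K M : 'M[F]_n) :
  contraction K -> `|\tr (K *m M)| <= trnorm M.
Proof.
move=> hK; have [U [UU UM]] := polar_isometry M (leqnn n).
have [V [s [VV VV' s_ge0 sqE _]]] := sqrtmx_gram M.
have -> : trnorm M = \sum_i s 0 i.
  by rewrite /trnorm sqE mxtrace_mulC mulmxA VV mul1mx mxtrace_diag.
have -> : M = U *m (V ^t* *m diag_mx s *m V).
  by rewrite -sqE -UM mulmxA (mulmx1C UU) mul1mx.
rewrite !mulmxA mxtrace_mulC !mulmxA.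
set L := V *m K *m U *m V ^t*.
have hL : contraction L.
  have hV : contraction V by exact: isometry_contraction.
  have hU : contraction U by exact: isometry_contraction.
  apply: contractionM (contraction_adj hV).
  exact: contractionM (contractionM hV hK) hU.
apply: le_trans (ler_norm_sum _ _ _) _; apply: ler_sum => i _.
rewrite mul_mx_diag mxE normrM (ger0_norm (s_ge0 i)).
by rewrite ler_piMl // contraction_diag_le1.
Qed.

(** The bound of [mxtrace_contraction_le] is attained: the trace norm is a maximum over
    contractions. The triangle inequality, [trnorm_conj] and the Hilbert-Schmidt bound follow by
    evaluating at a maximizer. *)
Lemma trnormE n (M : 'M[F]_n) :
  exists U : 'M[F]_n, U ^t* *m U = 1%:M /\ trnorm M = \tr (U ^t* *m M).
Proof.
by have [U [UU UM]] := polar_isometry M (leqnn n); exists U; rewrite UM.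
Qed.

Lemma trnorm_ge0 n (M : 'M[F]_n) : 0 <= trnorm M.
Proof.
apply: le_trans (mxtrace_contraction_le M (K := 0) _) => // v.
by rewrite mul0mx -[0](scale0r v) norm2sqZ normr0 expr0n mul0r norm2sq_ge0.
Qed.

Lemma trnormN n (M : 'M[F]_n) : trnorm (- M) = trnorm M.
Proof.
have adjN : (- M) ^t* = - M ^t* by apply/matrixP => i j; rewrite !mxE rmorphN.
by rewrite /trnorm adjN mulNmx mulmxN opprK.
Qed.

Lemma trnorm_triangle n (M N : 'M[F]_n) : trnorm (M + N) <= trnorm M + trnorm N.
Proof.
have [U [UU E]] := trnormE (M + N).
rewrite -[leLHS]ger0_norm ?trnorm_ge0 // E mulmxDr raddfD /=.
apply: le_trans (ler_normD _ _) _.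
by apply: lerD; apply/mxtrace_contraction_le/contraction_adj/isometry_contraction.
Qed.

Lemma trnorm_conj m n (K : 'M[F]_(m, n)) M :
  contraction K -> trnorm (K *m M *m K ^t*) <= trnorm M.
Proof.
move=> hK; have [U [UU E]] := trnormE (K *m M *m K ^t*).
rewrite -[leLHS]ger0_norm ?trnorm_ge0 // E !mulmxA mxtrace_mulC !mulmxA.
apply: mxtrace_contraction_le.
have hU : contraction (U ^t*) by exact/contraction_adj/isometry_contraction.
exact: contractionM (contractionM (contraction_adj hK) hU) hK.
Qed.

(** This brings the dimension of [C2 B R], or of [C1 A R], into the final bound. *)
Lemma trnorm_le_norm2 n (M : 'M[F]_n) : trnorm M ^+ 2 <= n%:R * norm2sq M.
Proof.
have [U [UU E]] := trnormE M.
rewrite -[trnorm M]ger0_norm ?trnorm_ge0 // E.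
apply: le_trans (mxtrace_CauchySchwarz _ _) _.
by rewrite /norm2sq UU mxtrace1.
Qed.

Lemma trnorm_rank1 n (u v : 'cV[F]_n) :
  trnorm (u *m v ^t*) <= sqrtC (norm2sq u * norm2sq v).
Proof.
have [U [UU E]] := trnormE (u *m v ^t*).
rewrite -[leLHS]ger0_norm ?trnorm_ge0 // E mulmxA mxtrace_mulC.
apply: le_trans (mxtrace_CauchySchwarz_sqrt _ _) _; rewrite mulrC.
rewrite ler_sqrtC ?qualifE /= ?mulr_ge0 ?norm2sq_ge0 //.
rewrite ler_wpM2r ?norm2sq_ge0 //.
exact/contraction_adj/isometry_contraction.
Qed.

(* [u u* - v v*] is half of [(u - v)(u + v)* + (u + v)(u - v)*]. *)
Lemma trnorm_pure_le n (u v : 'cV[F]_n) :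
  norm2sq u = 1 -> norm2sq v = 1 -> \tr (u ^t* *m v) \is Num.real ->
  trnorm (u *m u ^t* - v *m v ^t*)
    <= 2%:R * sqrtC (1 - \tr (u ^t* *m v) ^+ 2).
Proof.
move=> u1 v1; set c := \tr _ => c_real.
have vu : \tr (v ^t* *m u) = c.
  by rewrite -(CrealP c_real) -mxtrace_adj adjM trmxCK.
have nB : norm2sq (u - v) = 2%:R * (1 - c).
  rewrite /norm2sq adjB mulmxBl !mulmxBr !raddfB /= vu -/c.
  rewrite -[\tr _]/(norm2sq u) -[\tr (v ^t* *m v)]/(norm2sq v) u1 v1; ring.
have nD : norm2sq (u + v) = 2%:R * (1 + c).
  rewrite /norm2sq adjD mulmxDl !mulmxDr !raddfD /= vu -/c.
  rewrite -[\tr (u ^t* *m u)]/(norm2sq u) -[\tr (v ^t* *m v)]/(norm2sq v) u1 v1.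
  ring.
have h2 : (2%:R : F) != 0 by rewrite pnatr_eq0.
have -> : u *m u ^t* - v *m v ^t* =
    (2%:R^-1 *: (u - v)) *m (u + v) ^t* + (2%:R^-1 *: (u + v)) *m (u - v) ^t*.
  rewrite -!scalemxAl -scalerDr; apply: (scalerI h2); rewrite scalerA divff //.
  rewrite scale1r adjB adjD !mulmxDl !mulmxBr !mulmxDr !mulNmx scaler_nat mulr2n.
  set a := u *m _; set b := v *m v ^t*; set x := u *m v ^t*; set y := v *m _.
  by rewrite -[RHS]addrA; apply/matrixP => i j; rewrite !mxE; ring.
have half : `|2%:R^-1 : F| ^+ 2 * (2%:R * 2%:R) = 1.
  by rewrite ger0_norm ?invr_ge0 ?ler0n // exprVn -expr2 mulVf ?expf_neq0.
have prodE : `|2%:R^-1 : F| ^+ 2 * (2%:R * (1 - c)) * (2%:R * (1 + c)) = 1 - c ^+ 2.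
  transitivity (`|2%:R^-1 : F| ^+ 2 * (2%:R * 2%:R) * (1 - c ^+ 2)); first by ring.
  by rewrite half mul1r.
apply: le_trans (trnorm_triangle _ _) _.
rewrite [leRHS]mulr_natl [leRHS]mulr2n.
apply: lerD; apply: le_trans (trnorm_rank1 _ _) _; rewrite norm2sqZ nB nD.
  by rewrite prodE.
by rewrite mulrAC prodE.
Qed.

End TraceNorm.

Section Uhlmann.
Variable F : numClosedFieldType.

Lemma contraction_diag n (d : 'rV[F]_n) :
  (forall i, `|d 0 i| <= 1) -> contraction (diag_mx d).
Proof.
move=> d1 v; rewrite !norm2sqE; apply: ler_sum => i _; apply: ler_sum => j _.
by rewrite mul_diag_mx mxE ler_pXn2r ?qualifE //= normrM ler_piMl.
Qed.

Lemma gram_diag_ge0 m n (L : 'M[F]_(m, n)) i : 0 <= (L ^t* *m L) i i.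
Proof.
by rewrite mxE sumr_ge0 // => k _; rewrite adjE -normCKC exprn_ge0.
Qed.

(** Positivity is given as a factorization through [L], because that form survives a unitary change
    of basis and shows at once that diagonal entries are nonnegative. *)
Lemma sqrtmx_gramP m n (A : 'M[F]_(n, m)) (S := sqrtmx (A ^t* *m A)) :
  [/\ S ^t* = S, S *m S = A ^t* *m A & exists L : 'M[F]_m, S = L ^t* *m L].
Proof.
rewrite /S; have [V [s [VV VV' s_ge0 -> ->]]] := sqrtmx_gram A.
have adj_diag (d : 'rV[F]_m) : (forall i, 0 <= d 0 i) -> (diag_mx d) ^t* = diag_mx d.
  move=> d_ge0; rewrite tr_diag_mx map_diag_mx; congr diag_mx.
  by apply/rowP => i; rewrite mxE; apply/CrealP/ger0_real.
split.
- by rewrite !adjM trmxCK adj_diag // mulmxA.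
- rewrite -[RHS]mulmxA -!mulmxA; congr (_ *m _).
  rewrite (mulmxA V) VV mul1mx mulmxA; congr (_ *m _).
  by apply/matrixP => i j; rewrite mul_diag_mx !mxE mulrnAr -expr2.
- pose r := map_mx sqrtC s.
  have r_ge0 i : 0 <= r 0 i by rewrite mxE sqrtC_ge0.
  exists (diag_mx r *m V); rewrite adjM adj_diag // -!mulmxA; congr (_ *m _).
  rewrite mulmxA; congr (_ *m _).
  by apply/matrixP => i j; rewrite mul_diag_mx !mxE mulrnAr -expr2 sqrtCK.
Qed.

(* Padding A with zero rows removes the dimension constraint of
   [polar_isometry]; compressing the isometry back leaves a contraction. *)
Lemma polar_contraction m n (A : 'M[F]_(n, m)) :
  exists U : 'M[F]_(n, m),
    contraction U /\ U ^t* *m A = sqrtmx (A ^t* *m A).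
Proof.
have [U [UU UA]] := polar_isometry (col_mx A (0 : 'M[F]_m)) (leq_addl _ _).
have adj_col p q r (X : 'M[F]_(p, r)) (Y : 'M[F]_(q, r)) :
    (col_mx X Y) ^t* = row_mx (X ^t*) (Y ^t*).
  by rewrite tr_col_mx map_row_mx.
have grE : (col_mx A (0 : 'M[F]_m)) ^t* *m col_mx A 0 = A ^t* *m A.
  by rewrite adj_col mul_row_col mulmx0 addr0.
pose J := col_mx (1%:M : 'M[F]_n) (0 : 'M[F]_(m, n)).
have usubE : usubmx U = J ^t* *m U.
  by rewrite -{2}[U]vsubmxK adj_col mul_row_col adj1 mul1mx trmx0 map_mx0 mul0mx addr0.
exists (usubmx U); split.
  rewrite usubE; apply: contractionM; last exact: isometry_contraction.
  apply/contraction_adj/isometry_contraction.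
  by rewrite adj_col mul_row_col adj1 mulmx1 trmx0 map_mx0 mul0mx addr0.
rewrite -grE -UA -{2}[U]vsubmxK adj_col mul_row_col mulmx0 addr0 //.
Qed.

(** Test S^2 - T^2 against the sign of D = S - T: the trace is tr(|D| (S + T)). In an eigenbasis of
    D, the diagonal of S + T dominates that of |D|, so this trace is at least the sum of the squared
    eigenvalues of D. *)
Lemma Powers_Stormer m n p (A : 'M[F]_(n, m)) (B : 'M[F]_(p, m)) :
  norm2sq (sqrtmx (A ^t* *m A) - sqrtmx (B ^t* *m B))
    <= trnorm (A ^t* *m A - B ^t* *m B).
Proof.
have [] := sqrtmx_gramP A; have [] := sqrtmx_gramP B.
set S := sqrtmx (A ^t* *m A); set T := sqrtmx (B ^t* *m B).
move=> Tadj <- [LT TE] Sadj <- [LS SE].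
clearbody S T; pose D := S - T.
have Dadj : D ^t* = D by rewrite adjB Sadj Tadj.
have D_herm : D \is hermsymmx.
  by apply/is_hermitianmxP; rewrite expr0 scale1r Dadj.
pose V := spectralmx D; pose d := spectral_diag D.
have V_unitary : V \is unitarymx by exact: spectral_unitarymx.
have VV : V *m V ^t* = 1%:M by exact/unitarymxP.
have VV' : V ^t* *m V = 1%:M by exact: mulmx1C.
have DE : D = V ^t* *m diag_mx d *m V.
  rewrite -(invmx_unitary V_unitary).
  exact/orthomx_spectralP/hermitian_normalmx.
have d_real i : d 0 i \is Num.real.
  by have /mxOverP := hermitian_spectral_diag_real D_herm; apply.
pose sg := V ^t* *m diag_mx (\row_i ((-1) ^+ (d 0 i < 0)%R)) *m V.
pose absD := V ^t* *m diag_mx (\row_i `|d 0 i|) *m V.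
have fun_mul (x y : 'rV[F]_m) :
    (V ^t* *m diag_mx x *m V) *m (V ^t* *m diag_mx y *m V)
    = V ^t* *m diag_mx (\row_i (x 0 i * y 0 i)) *m V.
  rewrite -!mulmxA; congr (_ *m _); rewrite (mulmxA V) VV mul1mx mulmxA.
  congr (_ *m _); apply/matrixP => i j.
  by rewrite mul_diag_mx !mxE mulrnAr.
have sgD : sg *m D = absD.
  rewrite DE fun_mul /absD; congr (_ *m diag_mx _ *m _).
  by apply/rowP => i; rewrite !mxE -real_normrEsign.
have Dsg : D *m sg = absD.
  rewrite DE fun_mul /absD; congr (_ *m diag_mx _ *m _).
  by apply/rowP => i; rewrite !mxE mulrC -real_normrEsign.
have sg_contr : contraction sg.
  have hV : contraction V by exact: isometry_contraction.
  apply: contractionM hV; apply: contractionM.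
    by apply: contraction_adj; exact: isometry_contraction.
  by apply: contraction_diag => i; rewrite mxE normr_sign.
have diagV (M : 'M[F]_m) : \tr (absD *m M) = \sum_i `|d 0 i| * (V *m M *m V ^t*) i i.
  rewrite /absD -!mulmxA mxtrace_mulC -!mulmxA; apply: eq_bigr => i _.
  by rewrite mul_diag_mx !mxE.
clearbody sg absD.
have h2 : (2%:R : F) != 0 by rewrite pnatr_eq0.
(* Twice S^2 - T^2 is D (S + T) + (S + T) D, and [sg] commutes with D. *)
have trE : \tr (sg *m (S *m S - T *m T)) = \tr (absD *m (S + T)).
  apply: (mulfI h2); rewrite !mulr_natl !mulr2n.
  rewrite -{1}sgD -Dsg -[D *m sg *m _]mulmxA [\tr (D *m (sg *m _))]mxtrace_mulC.
  rewrite -!mulmxA -!mxtraceD -!mulmxDr; congr (\tr (_ *m _)).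
  rewrite /D !(mulmxDl, mulmxDr, mulNmx, mulmxN).
  move: (S *m S) (S *m T) (T *m S) (T *m T) => ss st ts tt.
  by apply/matrixP => i j; rewrite !mxE; ring.
have -> : norm2sq (S - T) = \sum_i `|d 0 i| ^+ 2.
  rewrite /norm2sq -/D Dadj DE fun_mul mxtrace_mulC mulmxA VV mul1mx mxtrace_diag.
  by apply: eq_bigr => i _; rewrite mxE real_normK // expr2.
have diag_ge0 (L : 'M[F]_m) i : 0 <= (V *m (L ^t* *m L) *m V ^t*) i i.
  suff -> : V *m (L ^t* *m L) *m V ^t* = (L *m V ^t*) ^t* *m (L *m V ^t*).
    exact: gram_diag_ge0.
  by rewrite adjM trmxCK !mulmxA.
have VDV i : (V *m D *m V ^t*) i i = d 0 i.
  rewrite DE !mulmxA VV mul1mx -mulmxA VV mulmx1.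
  by rewrite mxE eqxx.
apply: le_trans (mxtrace_contraction_le _ sg_contr); rewrite trE diagV.
(* Write S + T as D + 2 T or as -D + 2 S, according to the sign of the eigenvalue. *)
have norm_le i : `|d 0 i| <= (V *m (S + T) *m V ^t*) i i.
  have [d_ge0|/ltW d_le0] := real_leP (real0 _) (d_real i).
    rewrite ger0_norm // (_ : S + T = D + 2%:R *: T); last first.
      by rewrite /D scaler_nat mulr2n addrA subrK.
    rewrite mulmxDr mulmxDl [leRHS]mxE VDV lerDl -scalemxAr -scalemxAl mxE TE.
    by rewrite mulr_ge0 ?ler0n.
  rewrite ler0_norm // (_ : S + T = - D + 2%:R *: S); last first.
    by rewrite /D scaler_nat mulr2n opprB addrA subrK addrC.
  rewrite mulmxDr mulmxDl mulmxN mulNmx [leRHS]mxE [X in _ <= X + _]mxE VDV.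
  by rewrite lerDl -scalemxAr -scalemxAl mxE SE mulr_ge0 ?ler0n.
rewrite [leRHS]ger0_norm; last first.
  apply: sumr_ge0 => i _; apply: mulr_ge0 => //.
  exact: le_trans (norm_le i).
by apply: ler_sum => i _; rewrite expr2 ler_wpM2l.
Qed.

Lemma polar_decomposition m n (A U : 'M[F]_(n, m)) :
  U ^t* *m U = 1%:M -> U ^t* *m A = sqrtmx (A ^t* *m A) ->
  A = U *m sqrtmx (A ^t* *m A).
Proof.
move=> UU UA; have [Sadj SS _] := sqrtmx_gramP A.
set S := sqrtmx _ in UA Sadj SS *; clearbody S.
have AU : A ^t* *m U = S by rewrite -[U]trmxCK -adjM UA Sadj.
apply/eqP; rewrite -subr_eq0; apply/eqP/norm2sq_eq0.
rewrite /norm2sq adjB adjM Sadj mulmxBl !mulmxBr -!mulmxA UA.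
by rewrite (mulmxA _ U) AU (mulmxA _ U) UU mul1mx SS !subrr mxtrace0.
Qed.

(** [X] and [Y] are amplitude matrices of two purifications, whose marginals on the common system
    are the Gram matrices up to transposition. The polar isometry of [G] makes the overlap [c] equal
    to tr|G|, the fidelity. *)
Lemma Uhlmann_mx p q s (X : 'M[F]_(p, s)) (Y : 'M[F]_(q, s)) :
  (p <= q)%N -> norm2sq X = 1 -> norm2sq Y = 1 ->
  exists W : 'M[F]_(q, p), W ^t* *m W = 1%:M /\
    let c := \tr ((W *m X) ^t* *m Y) in
    0 <= c /\ 1 - c ^+ 2 <= trnorm (X ^t* *m X - Y ^t* *m Y).
Proof.
move=> le_pq X1 Y1; pose G := Y *m X ^t*.
have [W [WW WG]] := polar_isometry G le_pq; exists W; split=> // c.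
set Q := sqrtmx _ in WG.
have [Qadj QQ [L QE]] := sqrtmx_gramP G; rewrite -/Q in Qadj QQ QE.
have cE : c = \tr Q by rewrite /c adjM -mulmxA mxtrace_mulC -mulmxA -WG.
have c_ge0 : 0 <= c.
  by rewrite cE QE; apply: sumr_ge0 => i _; apply: gram_diag_ge0.
have c_le1 : c <= 1.
  rewrite -(@ler_pXn2r _ 2) ?qualifE //= expr1n -[c]ger0_norm //.
  apply: le_trans (mxtrace_CauchySchwarz _ _) _.
  by rewrite norm2sq_isometry // X1 Y1 mulr1.
split=> //.
have GE : G = W *m Q by exact: polar_decomposition.
have [U [hU UX]] := polar_contraction X; have [U' [hU' UY]] := polar_contraction Y.
have [Sadj SS _] := sqrtmx_gramP X; have [Tadj TT _] := sqrtmx_gramP Y.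
set S := sqrtmx (X ^t* *m X) in UX Sadj SS.
set T := sqrtmx (Y ^t* *m Y) in UY Tadj TT.
(* [S] and [T] are contractions applied to [X] and [Y], so tr(S T) is the trace of a contraction
   times [Q], hence at most tr Q. *)
have ST_le : `|\tr (S *m T)| <= c.
  rewrite -{1}Sadj -UX -UY adjM trmxCK -!mulmxA mxtrace_mulC -!mulmxA -/G GE.
  rewrite 2!mulmxA; apply: le_trans (mxtrace_contraction_le _ _) _.
    apply: contractionM; last exact: isometry_contraction.
    exact: contractionM hU (contraction_adj hU').
  by rewrite /trnorm Qadj QQ cE.
have ST_real : \tr (S *m T) \is Num.real.
  by apply/CrealP; rewrite -mxtrace_adj adjM Sadj Tadj mxtrace_mulC.
(* The chain is 1 - c^2 <= 2 - 2 c <= 2 - 2 tr(S T), where the last term is the squared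
   Hilbert-Schmidt norm of S - T. *)
have := Powers_Stormer X Y; rewrite -/S -/T => /(le_trans _); apply.
have -> : norm2sq (S - T) = 2%:R - 2%:R * \tr (S *m T).
  rewrite /norm2sq adjB Sadj Tadj mulmxBl !mulmxBr !raddfB /= SS TT.
  rewrite -[\tr (X ^t* *m X)]/(norm2sq X) -[\tr (Y ^t* *m Y)]/(norm2sq Y) X1 Y1.
  rewrite [\tr (T *m S)]mxtrace_mulC; ring.
apply: (@le_trans _ _ (2%:R - 2%:R * c)).
  rewrite -subr_ge0.
  have -> : 2%:R - 2%:R * c - (1 - c ^+ 2) = (1 - c) ^+ 2 by ring.
  by rewrite exprn_ge0 // subr_ge0.
rewrite lerD2l lerN2 ler_wpM2l ?ler0n //.
exact: le_trans (real_ler_norm ST_real) ST_le.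
Qed.

End Uhlmann.

(** * Decoupling by a finite random ensemble of unitaries *)

Section Fourier.
Variable F : numClosedFieldType.

(** In characteristic 0 the polynomial X^n - 1 is separable, so it has the n distinct roots that
    [has_prim_root] asks for. *)
Lemma exists_prim_root n : (0 < n)%N -> exists z : F, n.-primitive_root z.
Proof.
move=> n_gt0; pose p : {poly F} := 'X^n - 1.
have [r Dp] := closed_field_poly_normal p.
move: Dp; rewrite (monicP _) ?monicXnsubC // scale1r => Dp.
have sz_p : size p = n.+1 by rewrite size_XnsubC.
have rn1 : all n.-unity_root r.
  by apply/allP=> z zr; change (root p z); rewrite Dp root_prod_XsubC.
have sz_r : (n < (size r).+1)%N.
  by rewrite -(size_prod_XsubC r id) -Dp sz_p.
have uniq_r : uniq r.
  rewrite -separable_prod_XsubC -Dp separable_Xn_sub_1 //.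
  by rewrite pnatr_eq0 -lt0n.
by have /hasP[z _ hz] := has_prim_root n_gt0 rn1 uniq_r sz_r; exists z.
Qed.

Lemma sum_prim_root n (w : F) k : n.-primitive_root w -> ~~ (n %| k)%N ->
  \sum_(i < n) w ^+ (i * k) = 0.
Proof.
move=> w_prim k_ndvd.
have wk_neq1 : w ^+ k - 1 != 0 by rewrite subr_eq0 -(prim_order_dvd w_prim).
apply: (mulfI wk_neq1); rewrite mulr0.
under eq_bigr do rewrite mulnC exprM.
by rewrite -subrX1 -exprM mulnC exprM (prim_expr_order w_prim) expr1n subrr.
Qed.

Lemma exists_flat_unitary n : (0 < n)%N -> exists H : 'M[F]_n,
  H ^t* *m H = 1%:M /\ forall i j, `|H i j| ^+ 2 = n%:R^-1.
Proof.
move=> n_gt0; have [w w_prim] := exists_prim_root n_gt0.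
have n_neq0 : (n%:R : F) != 0 by rewrite pnatr_eq0 -lt0n.
have w1 : `|w| = 1.
  apply/eqP; rewrite -(@pexpr_eq1 _ _ n) //.
  by rewrite -normrX (prim_expr_order w_prim) normr1.
have ww : w * w^* = 1 by rewrite -normCK w1 expr1n.
have wE (i j k : nat) : (j <= k)%N ->
    (w ^+ (i * j))^* * w ^+ (i * k) = w ^+ (i * (k - j)).
  move=> le_jk; rewrite rmorphXn /= -{1}(subnKC le_jk) mulnDr exprD mulrA -exprMn.
  by rewrite mulrC [w^* * _]mulrC ww expr1n mulr1.
pose H := \matrix_(i < n, j < n) ((sqrtC n%:R)^-1 * w ^+ (i * j)) : 'M[F]_n.
have sqn : ((sqrtC n%:R)^-1)^* * (sqrtC n%:R)^-1 = n%:R^-1 :> F.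
  rewrite -normCKC ger0_norm ?invr_ge0 ?sqrtC_ge0 ?ler0n //.
  by rewrite exprVn sqrtCK.
exists H; split=> [|i j]; last first.
  rewrite normCKC mxE rmorphM /= mulrACA sqn rmorphXn -exprMn.
  by rewrite mulrC /= [_^* * _]mulrC ww expr1n mul1r.
have HE (j k : 'I_n) : (H ^t* *m H) j k
    = n%:R^-1 * \sum_(i < n) (w ^+ (i * j))^* * w ^+ (i * k).
  rewrite mxE mulr_sumr; apply: eq_bigr => i _.
  by rewrite adjE !mxE rmorphM mulrACA /= sqn.
(* Exponents are natural numbers, so k - j needs [j <= k]; the other half follows by taking
   adjoints. *)
have main (j k : 'I_n) : (j <= k)%N -> (H ^t* *m H) j k = (1%:M : 'M[F]_n) j k.
  move=> le_jk; rewrite HE mxE; under eq_bigr do rewrite wE //.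
  have [->|neq_jk] := eqVneq j k.
    rewrite subnn; under eq_bigr do rewrite muln0 expr0.
    by rewrite sumr_const card_ord mulVf.
  rewrite (sum_prim_root w_prim) ?mulr0 //.
  have lt_jk : (j < k)%N by rewrite ltn_neqAle le_jk andbT.
  apply/negP => /dvdn_leq; rewrite subn_gt0 lt_jk => /(_ isT).
  rewrite leqNgt => /negP; apply; apply: leq_ltn_trans (ltn_ord k).
  exact: leq_subr.
apply/matrixP => j k; have [le_jk|/ltnW le_kj] := leqP j k; first exact: main.
have HH : (H ^t* *m H) ^t* = H ^t* *m H by rewrite adjM trmxCK.
by rewrite -HH adjE main // -adjE adj1.
Qed.

End Fourier.

Section Phases.
Variables (F : numClosedFieldType) (n : nat).

Local Notation phases := {ffun 'I_n -> 'I_4}.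
Implicit Types (z : phases) (a b c : 'I_n).

(** Fourth roots of unity and not signs: the square of a phase must also have mean 0, to exclude the
    pairing a = b', b = a'. *)
Definition phase z a : F := 'i ^+ z a.

Lemma phaseK z a : phase z a * (phase z a)^* = 1.
Proof. by rewrite -normCK normrX normCi !expr1n. Qed.

Definition shift_phase x z : phases :=
  [ffun c => if c == x then inord ((z c).+1 %% 4) else z c].

Lemma shift_phaseE x z c :
  phase (shift_phase x z) c = phase z c * (if c == x then 'i else 1).
Proof.
rewrite /phase ffunE; case: eqP => _; last by rewrite mulr1.
rewrite inordK ?ltn_mod // -exprSr [in RHS](divn_eq (z c).+1 4) exprD mulnC exprM.
have -> : 'i ^+ 4 = 1 :> F by rewrite (exprM _ 2 2) sqrCi sqrrN expr1n.
by rewrite expr1n mul1r.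
Qed.

Lemma shift_phase_inj x : injective (shift_phase x).
Proof.
move=> z z' /ffunP E; apply/ffunP => c; have := E c; rewrite !ffunE.
case: eqP => // _ /(congr1 val) /=; rewrite !inordK ?ltn_mod //.
case: (z c) => [] [|[|[|[|]]]] //= ?; case: (z' c) => [] [|[|[|[|]]]] //= ? _;
  exact: val_inj.
Qed.

(** The index patterns for which the four phases cancel identically. *)
Definition matched a b a' b' : bool :=
  if a == b then a' == b' else (a == a') && (b == b').

(* The fourth moments of i.i.d. uniform powers of ['i]: shifting the phase of
   one unmatched index multiplies the sum by a factor different from 1. *)
Lemma phase_moment a b a' b' :
  \sum_z (phase z a * (phase z b)^*) * (phase z a' * (phase z b')^*)^*
  = #|{: phases}|%:R * (matched a b a' b')%:R.
Proof.
have N1 : -1 != 1 :> F by rewrite -subr_eq0 -opprD oppr_eq0 -mulr2n pnatr_eq0.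
have i1 : 'i != 1 :> F by apply: contra_neq N1 => i1; rewrite -(sqrCi F) i1 expr1n.
have Ni1 : - 'i != 1 :> F.
  by apply: contra_neq N1 => i1'; rewrite -(sqrCi F) -sqrrN i1' expr1n.
pose u x c : F := if c == x then 'i else 1.
have shift x : \sum_z (phase z a * (phase z b)^*) * (phase z a' * (phase z b')^*)^*
   = (\sum_z (phase z a * (phase z b)^*) * (phase z a' * (phase z b')^*)^*)
     * (u x a * (u x b)^* * (u x a' * (u x b')^*)^*).
  rewrite {1}(reindex_inj (@shift_phase_inj x)) mulr_suml; apply: eq_bigr => z _.
  by rewrite !shift_phaseE !rmorphM /= !conjCK /u; ring.
have vanish x : u x a * (u x b)^* * (u x a' * (u x b')^*)^* != 1 ->
    \sum_z (phase z a * (phase z b)^*) * (phase z a' * (phase z b')^*)^* = 0.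
  move=> neq1; have /eqP := shift x; rewrite eq_sym -subr_eq0 -{2}[\sum_z _]mulr1.
  by rewrite -mulrBr mulf_eq0 subr_eq0 (negPf neq1) orbF => /eqP.
have ii : 'i * 'i = -1 :> F by rewrite -expr2 sqrCi.
rewrite /matched; have [eq_ab|neq_ab] := eqVneq a b; first subst b.
  have [<-|neq_a'b'] := eqVneq a' b'.
    under eq_bigr do rewrite !phaseK rmorph1 mulr1.
    by rewrite sumr_const mulr1.
  rewrite mulr0; apply: (vanish a').
  rewrite /u eqxx [b' == _]eq_sym (negPf neq_a'b') rmorph1 mulr1 conjCi.
  have -> : (if a == a' then 'i else 1) * (if a == a' then 'i else 1)^* = 1 :> F.
    by case: eqP; rewrite ?rmorph1 ?mulr1 // -normCK normCi expr1n.
  by rewrite mul1r.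
have [eq_aa'|neq_aa'] := eqVneq a a'; first subst a'.
  have [<-|neq_bb'] := eqVneq b b'.
    under eq_bigr do
      rewrite -normCK normrM norm_conjC !normrX normCi !expr1n mulr1 expr1n.
    by rewrite sumr_const mulr1.
  rewrite mulr0; apply: (vanish b).
  rewrite /u eqxx (negPf neq_ab) [b' == _]eq_sym (negPf neq_bb') rmorph1 !mul1r conjCi.
  by rewrite rmorph1 mulr1.
(* Here [a] differs from [b] and [a'], so the factor is -1 if [b' = a] and ['i] otherwise. *)
rewrite mulr0; apply: (vanish a).
rewrite /u eqxx [b == _]eq_sym (negPf neq_ab) [a' == _]eq_sym (negPf neq_aa').
rewrite rmorph1 mulr1 mul1r conjCK; case: (b' == a); rewrite ?ii ?mulr1 //.
Qed.

(** Applied with [I] the traced-out labels of one block, for the outer phases, and with [I] all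
    pairs of indices, for the inner ones. *)
Lemma phase_average (I : finType) (al be : I -> 'I_n) (G : I -> F) :
  \sum_z `|\sum_i phase z (al i) * (phase z (be i))^* * G i| ^+ 2
  = #|{: phases}|%:R *
    \sum_i \sum_j (matched (al i) (be i) (al j) (be j))%:R * (G i * (G j)^*).
Proof.
under eq_bigr => z _.
  rewrite normCK rmorph_sum big_distrlr /=.
  over.
rewrite exchange_big mulr_sumr /=; apply: eq_bigr => i _.
rewrite exchange_big mulr_sumr /=; apply: eq_bigr => j _.
rewrite mulrA -phase_moment mulr_suml; apply: eq_bigr => z _.
by rewrite [(_ * G j)^*]rmorphM /=; ring.
Qed.

End Phases.

Lemma sum_pair (F : numClosedFieldType) (X Y : finType) (f : X * Y -> F) :
  \sum_p f p = \sum_x \sum_y f (x, y).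
Proof. by rewrite pair_big; apply: eq_bigr => -[]. Qed.

Lemma sumr_offdiag_const (F : numClosedFieldType) (I : finType) (c : F) :
  \sum_(i : I) \sum_(j | j != i) c = #|I|%:R * (#|I|%:R - 1) * c.
Proof.
rewrite -mulrA; under eq_bigr => a _.
  rewrite (_ : \sum_(b | b != a) c = (#|I|%:R - 1) * c); last first.
    rewrite sumr_const cardC1 mulrBl mul1r mulr_natl.
    have : (0 < #|I|)%N by apply/card_gt0P; exists a.
    by case: #|I| => // m _ /=; rewrite mulrS addrC addrK.
  over.
by rewrite sumr_const mulr_natl.
Qed.

Section PermAverage.
Variables (F : numClosedFieldType) (n : nat).

Definition offdiag (f : 'I_n -> 'I_n -> F) : F := \sum_a \sum_(b | b != a) f a b.

Lemma offdiag_perm f (s : 'S_n) :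
  offdiag (fun a b => f (s a) (s b)) = offdiag f.
Proof.
rewrite /offdiag [RHS](reindex_inj (@perm_inj _ s)); apply: eq_bigr => a _.
rewrite [RHS](reindex_inj (@perm_inj _ s)); apply: eq_bigl => b.
by rewrite (inj_eq perm_inj).
Qed.

Lemma exists_perm2 (i j a b : 'I_n) : i != j -> a != b ->
  exists s : 'S_n, s i = a /\ s j = b.
Proof.
move=> ij ab; exists (tperm i a * tperm (tperm i a j) b)%g.
have ja : tperm i a j != a.
  by rewrite -(inj_eq (@perm_inj _ (tperm i a))) tpermK tpermR eq_sym.
by rewrite !permM tpermL tpermL; split=> //; apply: tpermD; rewrite // eq_sym.
Qed.

Lemma offdiag_const (c : F) : offdiag (fun _ _ => c) = n%:R * (n%:R - 1) * c.
Proof. by rewrite /offdiag sumr_offdiag_const card_ord. Qed.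

Lemma offdiag_split (f : 'I_n -> 'I_n -> F) :
  \sum_a \sum_b f a b = \sum_a f a a + offdiag f.
Proof.
rewrite /offdiag -big_split /=; apply: eq_bigr => a _.
by rewrite (bigD1 a).
Qed.

(** By double transitivity the sum is the same for every pair of distinct indices, and the total
    over all such pairs is invariant under each permutation. *)
Lemma perm_pair_average f (i j : 'I_n) : i != j ->
  \sum_(s : 'S_n) f (s i) (s j)
  = #|{: 'S_n}|%:R * ((n%:R * (n%:R - 1))^-1 * offdiag f).
Proof.
move=> ij; pose S a b := \sum_(s : 'S_n) f (s a) (s b).
have SE a b : a != b -> S a b = S i j.
  move=> /(exists_perm2 ij)[t [ti tj]]; rewrite /S [RHS](reindex_inj (mulgI t)).
  by apply: eq_bigr => s _; rewrite !permM ti tj.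
have tot : offdiag S = #|{: 'S_n}|%:R * offdiag f.
  rewrite mulr_natl -sumr_const.
  under [RHS]eq_bigr => s _ do rewrite -(offdiag_perm f s).
  rewrite [RHS]exchange_big; apply: eq_bigr => a _.
  by rewrite [RHS]exchange_big.
have n2 : (n%:R * (n%:R - 1) : F) != 0.
  have n_gt1 : (1 < n)%N.
    rewrite ltnNge; apply: contra ij => n_le1; rewrite -val_eqE /=.
    have := ltn_ord i; have := ltn_ord j.
    by case: n n_le1 (val i) (val j) => [|[]]// _ [|?] [|?].
  apply: mulf_neq0; first by rewrite pnatr_eq0 -lt0n ltnW.
  by rewrite subr_eq0 pnatr_eq1 gtn_eqF.
rewrite -[LHS]/(S i j) mulrCA -tot.
have -> : offdiag S = n%:R * (n%:R - 1) * S i j.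
  rewrite -offdiag_const; apply: eq_bigr => a _; apply: eq_bigr => b ba.
  by rewrite SE // eq_sym.
by rewrite mulKf.
Qed.

End PermAverage.

Section Decoupling.
Variables (F : numClosedFieldType) (n : nat).
Local Notation phases := {ffun 'I_n -> 'I_4}.
Implicit Types (M N A : 'M[F]_n) (w z : phases) (s : 'S_n).

Definition diagsq N : F := \sum_a `|N a a| ^+ 2.

Lemma norm2sq_split N : norm2sq N = diagsq N + offdiag (fun a b => `|N a b| ^+ 2).
Proof. by rewrite norm2sqE offdiag_split. Qed.

Lemma offdiag_trace N :
  offdiag (fun a b => N a a * (N b b)^*) = `|\tr N| ^+ 2 - diagsq N.
Proof.
rewrite normCK rmorph_sum big_distrlr /= offdiag_split.
have -> : diagsq N = \sum_a N a a * (N a a)^*.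
  by apply: eq_bigr => a _; rewrite normCK.
by rewrite [RHS]addrC addKr.
Qed.

(** [g] factors the index set into a kept system [K] and a traced-out system [E]. It is a parameter
    because two factorizations of the same space are used with one [U]. *)
Variables (K E : finType) (g : K * E -> 'I_n).
Hypothesis g_bij : bijective g.

Let x : F := #|K|%:R.
Let y : F := #|E|%:R.

Lemma card_split : n%:R = x * y :> F.
Proof. by rewrite -natrM -card_prod (bij_eq_card g_bij) card_ord. Qed.

Lemma sum_split (f : 'I_n -> F) : \sum_a f a = \sum_k \sum_e f (g (k, e)).
Proof.
rewrite (reindex g); last exact: onW_bij.
by rewrite pair_big; apply: eq_bigr => -[].
Qed.

(** In blocks with k = k' the phases cancel and products of two diagonal entries remain; for k <> k'
    they remove all cross terms. Permutations then average over pairs of distinct indices. Besides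
    norm and trace, only [diagsq N] is left. *)
Lemma phase_perm_average N :
  \sum_(s : 'S_n) \sum_(z : phases) \sum_k \sum_k'
    `|\sum_e phase F z (g (k, e)) * (phase F z (g (k', e)))^*
        * N (s (g (k, e))) (s (g (k', e)))| ^+ 2
  = #|{: 'S_n}|%:R * (#|{: phases}|%:R *
    (diagsq N
     + (n%:R * (n%:R - 1))^-1 *
       (x * (y * (y - 1)) * (`|\tr N| ^+ 2 - diagsq N)
        + x * (x - 1) * y * offdiag (fun a b => `|N a b| ^+ 2)))).
Proof.
have g_inj := bij_inj g_bij.
have sum_const (I : finType) (u : F) : \sum_(i : I) u = #|I|%:R * u.
  by rewrite sumr_const mulr_natl.
pose c : F := (n%:R * (n%:R - 1))^-1.
pose D k e e' s :=
  N (s (g (k, e))) (s (g (k, e))) * (N (s (g (k, e'))) (s (g (k, e'))))^*.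
pose O k k' e s := `|N (s (g (k, e))) (s (g (k', e)))| ^+ 2.
have step1 s : \sum_(z : phases) \sum_k \sum_k'
    `|\sum_e phase F z (g (k, e)) * (phase F z (g (k', e)))^*
        * N (s (g (k, e))) (s (g (k', e)))| ^+ 2
   = #|{: phases}|%:R * (\sum_k \sum_e \sum_e' D k e e' s
                         + \sum_k \sum_(k' | k' != k) \sum_e O k k' e s).
  rewrite exchange_big -big_split mulr_sumr /=; apply: eq_bigr => k _.
  rewrite exchange_big (bigD1 k) //= mulrDr [X in _ = _ + X]mulr_sumr; congr (_ + _).
    rewrite phase_average; congr (_ * _); apply: eq_bigr => e _.
    by apply: eq_bigr => e' _; rewrite /matched !eqxx mul1r.
  apply: eq_bigr => k' neq_kk'.
  rewrite phase_average; congr (_ * _); apply: eq_bigr => e _.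
  rewrite (bigD1 e) //= big1 => [|e' neq_e].
    rewrite addr0 /matched (inj_eq g_inj) xpair_eqE [k == _]eq_sym (negPf neq_kk').
    by rewrite !eqxx mul1r -normCK.
  rewrite /matched !(inj_eq g_inj) !xpair_eqE [k == _]eq_sym (negPf neq_kk') /=.
  by rewrite [e == _]eq_sym (negPf neq_e) andbF mul0r.
under eq_bigr do rewrite step1.
rewrite -mulr_sumr mulrCA; congr (_ * _); rewrite big_split /=.
rewrite -/c (mulrDr c) addrA mulrDr; congr (_ + _); last first.
  rewrite exchange_big /=.
  under eq_bigr => k _.
    rewrite exchange_big /=.
    under eq_bigr => k' neq_kk'.
      rewrite exchange_big /=.
      under eq_bigr => e _.
        rewrite (@perm_pair_average _ _ (fun a b => `|N a b| ^+ 2)); last first.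
          by rewrite (inj_eq g_inj) xpair_eqE eq_sym (negPf neq_kk').
        over.
      rewrite sum_const.
      over.
    over.
  by rewrite sumr_offdiag_const -/x -/y -/c; ring.
rewrite exchange_big /=.
transitivity (\sum_k \sum_e (\sum_(s : 'S_n) D k e e s
     + \sum_(e' | e' != e) #|{: 'S_n}|%:R * (c * (`|\tr N| ^+ 2 - diagsq N)))).
  apply: eq_bigr => k _; rewrite exchange_big; apply: eq_bigr => e _.
  rewrite exchange_big (bigD1 e) //=; congr (_ + _); apply: eq_bigr => e' neq_e.
  rewrite (@perm_pair_average _ _ (fun a b => N a a * (N b b)^*)) ?offdiag_trace //.
  by rewrite (inj_eq g_inj) xpair_eqE eqxx eq_sym.
under eq_bigr do rewrite big_split sumr_offdiag_const /=.
rewrite big_split /= [RHS]mulrDr; congr (_ + _); last first.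
  by rewrite !sum_const -/x -/y -/c; ring.
under eq_bigr do rewrite exchange_big.
rewrite exchange_big mulr_natl -sumr_const; apply: eq_bigr => s _ /=.
rewrite /diagsq (reindex_inj (@perm_inj _ s)) sum_split.
by apply: eq_bigr => k _; apply: eq_bigr => e _; rewrite /D -normCK.
Qed.

End Decoupling.

Section RandomUnitary.
Variables (F : numClosedFieldType) (n : nat).
Local Notation phases := {ffun 'I_n -> 'I_4}.
Implicit Types (M N A H : 'M[F]_n) (w z : phases) (s : 'S_n).

Definition phase_mx w : 'M[F]_n := diag_mx (\row_a phase F w a).

(** With [t = (w, s, z)]: [z] gives the outer phases, [s] the permutation, [w] the inner phases. *)
Definition random_unitary H (t : phases * 'S_n * phases) : 'M[F]_n :=
  phase_mx t.2 *m perm_mx t.1.2 *m (H *m phase_mx t.1.1).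

Lemma adj_phase_mx w : (phase_mx w) ^t* = diag_mx (\row_a (phase F w a)^*).
Proof.
by rewrite tr_diag_mx map_diag_mx; congr diag_mx; apply/rowP => i; rewrite !mxE.
Qed.

Lemma phase_mx_isometry w : (phase_mx w) ^t* *m phase_mx w = 1%:M.
Proof.
rewrite adj_phase_mx; apply/matrixP => i j; rewrite mul_diag_mx !mxE.
by rewrite mulrnAr mulrC phaseK.
Qed.

Lemma perm_mx_isometry s : (perm_mx s : 'M[F]_n) ^t* *m perm_mx s = 1%:M.
Proof. by rewrite tr_perm_mx map_perm_mx -perm_mxM mulVg perm_mx1. Qed.

Lemma random_unitary_isometry H t : H ^t* *m H = 1%:M ->
  (random_unitary H t) ^t* *m random_unitary H t = 1%:M.
Proof.
move=> HH; apply: isometryM.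
  by apply: isometryM; [exact: phase_mx_isometry|exact: perm_mx_isometry].
by apply: isometryM => //; exact: phase_mx_isometry.
Qed.

Lemma random_unitaryE H w s z M a b :
  let N := (H *m phase_mx w) *m M *m (H *m phase_mx w) ^t* in
  (random_unitary H (w, s, z) *m M *m (random_unitary H (w, s, z)) ^t*) a b
  = phase F z a * (phase F z b)^* * N (s a) (s b).
Proof.
move=> N.
have -> : random_unitary H (w, s, z) *m M *m (random_unitary H (w, s, z)) ^t*
    = phase_mx z *m (perm_mx s *m N *m (perm_mx s) ^t*) *m (phase_mx z) ^t*.
  by rewrite /random_unitary /N /= !adjM !mulmxA.
rewrite tr_perm_mx map_perm_mx -row_permE -col_permE adj_phase_mx mul_mx_diag.
by rewrite mxE mul_diag_mx !mxE mulrAC.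
Qed.

Lemma conj_isometry_trace (U M : 'M[F]_n) :
  U ^t* *m U = 1%:M -> \tr (U *m M *m U ^t*) = \tr M.
Proof. by move=> UU; rewrite mxtrace_mulC mulmxA UU mul1mx. Qed.

Lemma conj_isometry_norm2sq (U M : 'M[F]_n) :
  U ^t* *m U = 1%:M -> norm2sq (U *m M *m U ^t*) = norm2sq M.
Proof.
move=> UU; rewrite -mulmxA norm2sq_isometry // /norm2sq adjM trmxCK.
by rewrite mulmxA mxtrace_mulC !mulmxA UU mul1mx.
Qed.

Variable H : 'M[F]_n.
Hypothesis H_isometry : H ^t* *m H = 1%:M.
Hypothesis H_flat : forall i j, `|H i j| ^+ 2 = n%:R^-1.
Hypothesis n_gt0 : (0 < n)%N.

(* All entries of H have the same modulus, so H spreads the diagonal of M; this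
   makes up for the diagonal being fixed by the phases and permutations. *)
Lemma diagsq_average M :
  \sum_(w : phases) diagsq ((H *m phase_mx w) *m M *m (H *m phase_mx w) ^t*)
  <= #|{: phases}|%:R * ((norm2sq M + `|\tr M| ^+ 2) / n%:R).
Proof.
have n_neq0 : (n%:R : F) != 0 by rewrite pnatr_eq0 -lt0n.
pose G i (p : 'I_n * 'I_n) := H i p.1 * M p.1 p.2 * (H i p.2)^*.
have entryE w i : ((H *m phase_mx w) *m M *m (H *m phase_mx w) ^t*) i i
    = \sum_(p : 'I_n * 'I_n) phase F w p.1 * (phase F w p.2)^* * G i p.
  rewrite mxE; under eq_bigr => b _ do rewrite mxE mulr_suml.
  rewrite exchange_big pair_big /=; apply: eq_bigr => -[a b] _ /=.
  by rewrite adjE !mul_mx_diag !mxE rmorphM /G /=; ring.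
have normG i a b : `|G i (a, b)| ^+ 2 = n%:R^-1 ^+ 2 * `|M a b| ^+ 2.
  by rewrite /G /= !normrM norm_conjC !exprMn !H_flat; ring.
have sumG i : \sum_a G i (a, a) = n%:R^-1 * \tr M.
  rewrite mulr_sumr; apply: eq_bigr => a _.
  by rewrite /G /= mulrAC -normCK H_flat.
have avg i : \sum_(w : phases) `|\sum_(p : 'I_n * 'I_n)
      phase F w p.1 * (phase F w p.2)^* * G i p| ^+ 2
    = #|{: phases}|%:R * (n%:R^-1 ^+ 2 *
       (offdiag (fun a b => `|M a b| ^+ 2) + `|\tr M| ^+ 2)).
  rewrite phase_average; congr (_ * _).
  transitivity (\sum_a \sum_b \sum_a' \sum_b'
      (matched a b a' b')%:R * (G i (a, b) * (G i (a', b'))^*)).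
    rewrite [RHS]pair_big; apply: eq_bigr => -[a b] _.
    by rewrite [RHS]pair_big; apply: eq_bigr => -[a' b'] _.
  (* A pair with a <> b matches only itself. The diagonal pairs all match one another, which
     rebuilds the squared trace. *)
  rewrite offdiag_split addrC mulrDr; congr (_ + _).
    rewrite /offdiag mulr_sumr; apply: eq_bigr => a _.
    rewrite mulr_sumr; apply: eq_bigr => b neq_ab.
    rewrite -(normG i) (bigD1 a) //= [X in _ + X]big1 ?addr0 => [|a' neq_a].
      rewrite (bigD1 b) //= [X in _ + X]big1 ?addr0 => [|b' neq_b].
        by rewrite /matched eq_sym (negPf neq_ab) !eqxx mul1r -normCK.
      by rewrite /matched [a == b]eq_sym (negPf neq_ab) [b == b']eq_sym (negPf neq_b)
        andbF mul0r.
    rewrite big1 // => b' _.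
    by rewrite /matched [a == b]eq_sym (negPf neq_ab) [a == a']eq_sym (negPf neq_a)
      mul0r.
  transitivity (`|\sum_a G i (a, a)| ^+ 2).
    rewrite normCK rmorph_sum big_distrlr; apply: eq_bigr => a _.
    apply: eq_bigr => a' _; rewrite (bigD1 a') //= big1 => [|b' neq_b].
      by rewrite /matched !eqxx mul1r addr0.
    by rewrite /matched eqxx eq_sym (negPf neq_b) mul0r.
  by rewrite sumG normrM exprMn ger0_norm // invr_ge0 ler0n.
rewrite /diagsq exchange_big /=.
under eq_bigr => i _.
  under eq_bigr do rewrite entryE.
  rewrite avg; over.
rewrite sumr_const card_ord -mulrnAr ler_wpM2l ?ler0n // -[leLHS]mulr_natl.
rewrite expr2 !mulrA mulfV // mul1r mulrC ler_wpM2r ?invr_ge0 ?ler0n //.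
rewrite lerD2r norm2sq_split lerDr; apply: sumr_ge0 => a _.
exact: exprn_ge0.
Qed.

Variables (K E : finType) (g : K * E -> 'I_n).
Hypothesis g_bij : bijective g.

(** For fixed [w], the mean over permutations and outer phases is [al * diagsq (NM w) + be]. As [al]
    is nonnegative, the upper bound of [diagsq_average] can be inserted. *)
Lemma random_unitary_average M :
  \sum_t \sum_k \sum_k'
    `|\sum_e (random_unitary H t *m M *m (random_unitary H t) ^t*)
               (g (k, e)) (g (k', e))| ^+ 2
  <= #|{: phases * 'S_n * phases}|%:R *
     (norm2sq M / #|E|%:R + `|\tr M| ^+ 2 / #|K|%:R).
Proof.
pose NM w := (H *m phase_mx w) *m M *m (H *m phase_mx w) ^t*.
have Hw w : (H *m phase_mx w) ^t* *m (H *m phase_mx w) = 1%:M.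
  by apply: isometryM => //; exact: phase_mx_isometry.
set x : F := #|K|%:R; set y : F := #|E|%:R.
have nxy : n%:R = x * y := card_split F g_bij.
have n_card : n = (#|K| * #|E|)%N by rewrite -card_prod (bij_eq_card g_bij) card_ord.
have [x_gt0 y_gt0] : (0 < #|K|)%N /\ (0 < #|E|)%N.
  by move: n_gt0; rewrite n_card muln_gt0 => /andP.
have x1 : 1 <= x by rewrite ler1n.
have y1 : 1 <= y by rewrite ler1n.
pose N2 := norm2sq M; pose t2 := `|\tr M| ^+ 2.
pose c : F := (n%:R * (n%:R - 1))^-1.
pose al := 1 - c * (x * (y * (y - 1)) + x * (x - 1) * y).
pose be := c * (x * (y * (y - 1)) * t2 + x * (x - 1) * y * N2).
have -> : \sum_t \sum_k \sum_k'
    `|\sum_e (random_unitary H t *m M *m (random_unitary H t) ^t*)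
               (g (k, e)) (g (k', e))| ^+ 2
  = \sum_(w : phases) #|{: 'S_n}|%:R * (#|{: phases}|%:R * (al * diagsq (NM w) + be)).
  rewrite !sum_pair.
  apply: eq_bigr => w _.
  transitivity (\sum_(s : 'S_n) \sum_(z : phases) \sum_k \sum_k'
    `|\sum_e phase F z (g (k, e)) * (phase F z (g (k', e)))^*
        * NM w (s (g (k, e))) (s (g (k', e)))| ^+ 2).
    apply: eq_bigr => s _; apply: eq_bigr => z _.
    apply: eq_bigr => k _; apply: eq_bigr => k' _.
    by under eq_bigr do rewrite random_unitaryE.
  rewrite (phase_perm_average g_bij) conj_isometry_trace // -/x -/y -/c.
  have -> : offdiag (fun a b => `|NM w a b| ^+ 2) = N2 - diagsq (NM w).
    by rewrite /N2 -(conj_isometry_norm2sq M (Hw w)) norm2sq_split addrC addKr.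
  by rewrite /al /be -/t2; do 2 congr (_ * _); ring.
rewrite !card_prod !natrM -mulr_sumr -mulr_sumr big_split /= sumr_const -mulr_sumr.
rewrite -[be *+ _]mulr_natl.
(* For [n = 1] the inverse [c] is 0 by convention, so [al = 1] and [be = 0]. Otherwise the slack is
   an explicit nonnegative expression. *)
have al_be : 0 <= al /\ al * ((N2 + t2) / n%:R) + be <= N2 / y + t2 / x.
  have [n1|n_neq1] := eqVneq n 1%N.
    have [K1 E1] : (#|K| = 1 /\ #|E| = 1)%N.
      move: n_card; rewrite n1 => /esym/eqP; rewrite muln_eq1.
      by move=> /andP[/eqP-> /eqP->].
    rewrite /al /be /c n1 subrr mulr0 invr0 !mul0r subr0 mul1r addr0.
    by rewrite /x /y K1 E1 !divr1 ler01.
  have n_gt1 : (1 < n)%N by rewrite ltn_neqAle eq_sym n_neq1.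
  have x0 : x != 0 by rewrite pnatr_eq0 -lt0n.
  have y0 : y != 0 by rewrite pnatr_eq0 -lt0n.
  have xy1 : x * y - 1 != 0 by rewrite -nxy subr_eq0 pnatr_eq1 gtn_eqF.
  have c_ge0 : 0 <= c.
    by rewrite invr_ge0 mulr_ge0 ?ler0n // subr_ge0 ler1n.
  have t2_ge0 : 0 <= t2 by exact: exprn_ge0.
  have N2_ge0 : 0 <= N2 by exact: norm2sq_ge0.
  split.
    have -> : al = c * (x * y * ((x - 1) * (y - 1))).
      by rewrite /al /c nxy; field; rewrite ?xy1 ?x0 ?y0.
    apply: mulr_ge0 => //; apply: mulr_ge0; first by rewrite -nxy ler0n.
    by rewrite mulr_ge0 ?subr_ge0.
  rewrite -subr_ge0.
  have -> : N2 / y + t2 / x - (al * ((N2 + t2) / n%:R) + be)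
     = c * (N2 * (y - 1) + t2 * (x - 1)).
    by rewrite /al /be /c nxy; field; rewrite ?xy1 ?x0 ?y0.
  by rewrite mulr_ge0 // addr_ge0 // mulr_ge0 // subr_ge0.
have [al_ge0 le_al] := al_be.
rewrite -/N2 -/t2 -/x -/y.
have -> : #|{: phases}|%:R * #|{: 'S_n}|%:R * #|{: phases}|%:R * (N2 / y + t2 / x)
    = #|{: 'S_n}|%:R * (#|{: phases}|%:R * (#|{: phases}|%:R * (N2 / y + t2 / x))).
  by ring.
rewrite ler_wpM2l ?ler0n // ler_wpM2l ?ler0n //.
apply: le_trans (_ : #|{: phases}|%:R * (al * ((N2 + t2) / n%:R) + be) <= _).
  rewrite mulrDr lerD2r mulrCA ler_wpM2l //; exact: diagsq_average.
by rewrite ler_wpM2l ?ler0n.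
Qed.

End RandomUnitary.

Section DecouplingExists.
Variable F : numClosedFieldType.

(** The squared Hilbert-Schmidt distance from the marginal of [A] on [K] to the multiple of the
    identity with the same trace. *)
Definition decoupling_error n (K E : finType) (g : K * E -> 'I_n) (A : 'M[F]_n) : F :=
  \sum_k \sum_k' `|\sum_e A (g (k, e)) (g (k', e))
                   - (k == k')%:R * (\tr A / #|K|%:R)| ^+ 2.

Lemma decoupling_error_ge0 n (K E : finType) (g : K * E -> 'I_n) A :
  0 <= decoupling_error g A.
Proof.
by apply: sumr_ge0 => k _; apply: sumr_ge0 => k' _; apply: exprn_ge0.
Qed.

(** Pythagoras: the subtracted multiple of the identity is the orthogonal projection of the marginal
    onto the scalar matrices. *)
Lemma decoupling_errorE n (K E : finType) (g : K * E -> 'I_n) A :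
  bijective g -> (0 < #|K|)%N ->
  decoupling_error g A =
  \sum_k \sum_k' `|\sum_e A (g (k, e)) (g (k', e))| ^+ 2
  - `|\tr A| ^+ 2 / #|K|%:R.
Proof.
move=> g_bij K_gt0; set x : F := #|K|%:R; set t := \tr A.
have x0 : x != 0 by rewrite pnatr_eq0 -lt0n.
have x_conj : x^* = x by rewrite conjC_nat.
pose T k k' := \sum_e A (g (k, e)) (g (k', e)).
have trT : \sum_k T k k = t by rewrite /t /mxtrace (sum_split g_bij).
have sqE k k' : `|T k k' - (k == k')%:R * (t / x)| ^+ 2
   = `|T k k'| ^+ 2 + (k == k')%:R *
       (t * t^* / x ^+ 2 - T k k' * t^* / x - (T k k')^* * t / x).
  rewrite !normCK rmorphB rmorphM /= fmorph_div conjC_nat /= x_conj.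
  by case: (k == k'); rewrite ?mul1r ?mul0r ?subr0 ?addr0 //;
    move: (T k k') => z; field.
have diag_sum (f : K -> K -> F) : \sum_k \sum_k' (k == k')%:R * f k k' = \sum_k f k k.
  apply: eq_bigr => k _; rewrite (bigD1 k) //= eqxx mul1r big1 ?addr0 // => k' neq_k.
  by rewrite eq_sym (negPf neq_k) mul0r.
rewrite /decoupling_error -/t -/x.
under eq_bigr do under eq_bigr do rewrite sqE.
under eq_bigr do rewrite big_split /=.
rewrite big_split /= diag_sum; congr (_ + _).
rewrite !sumrB sumr_const -!mulr_suml trT.
have -> : \sum_k (T k k)^* = t^* by rewrite -trT rmorph_sum.
by rewrite -[_ *+ _]mulr_natl -/x normCK; field.
Qed.

Lemma exists_le_average (T : finType) (t0 : T) (h : T -> F) (c : F) :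
  (forall t, h t \is Num.real) -> c \is Num.real ->
  \sum_t h t <= #|T|%:R * c -> exists t, h t <= c.
Proof.
move=> h_real c_real le_hc; apply/existsP; apply: contraTT isT => /existsPn lt_ch.
have : \sum_(t : T) c < \sum_t h t.
  apply: ltr_sum => [|t _]; first by apply/hasP; exists t0; rewrite ?mem_index_enum.
  by rewrite real_ltNge.
by rewrite sumr_const -mulr_natl => /lt_le_trans/(_ le_hc); rewrite ltxx.
Qed.

(** Both errors are nonnegative, so a bound of 2 on the sum of their normalized values bounds each
    by 2. The families [M1], [M2] stand for the blocks of an operator on a larger system, with [U]
    acting on one factor. *)
Lemma decoupling_exists n (K1 E1 K2 E2 I1 I2 : finType)
    (g1 : K1 * E1 -> 'I_n) (g2 : K2 * E2 -> 'I_n)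
    (M1 : I1 -> 'M[F]_n) (M2 : I2 -> 'M[F]_n) :
  (0 < n)%N -> bijective g1 -> bijective g2 ->
  0 < \sum_i norm2sq (M1 i) -> 0 < \sum_i norm2sq (M2 i) ->
  exists U : 'M[F]_n, [/\ U ^t* *m U = 1%:M,
    \sum_i decoupling_error g1 (U *m M1 i *m U ^t*)
      <= 2%:R * (\sum_i norm2sq (M1 i)) / #|E1|%:R &
    \sum_i decoupling_error g2 (U *m M2 i *m U ^t*)
      <= 2%:R * (\sum_i norm2sq (M2 i)) / #|E2|%:R].
Proof.
move=> n_gt0 g1_bij g2_bij N1_gt0 N2_gt0.
have [H [HH H_flat]] := exists_flat_unitary F n_gt0.
pose U t := random_unitary H t.
have UU t : (U t) ^t* *m U t = 1%:M by exact: random_unitary_isometry.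
pose dev (K E I : finType) (g : K * E -> 'I_n) (M : I -> 'M[F]_n) t :=
  \sum_i decoupling_error g (U t *m M i *m (U t) ^t*).
have dev_ge0 (K E I : finType) (g : K * E -> 'I_n) (M : I -> 'M[F]_n) t :
    0 <= dev K E I g M t.
  by apply: sumr_ge0 => i _; apply: decoupling_error_ge0.
have card_gt0 (K E : finType) (g : K * E -> 'I_n) : bijective g ->
    (0 < #|K|)%N /\ (0 < #|E|)%N.
  move=> g_bij; move: n_gt0; rewrite -(card_ord n) -(bij_eq_card g_bij) card_prod.
  by rewrite muln_gt0 => /andP.
have dev_avg (K E I : finType) (g : K * E -> 'I_n) (M : I -> 'M[F]_n) : bijective g ->
    \sum_t dev K E I g M t <=
    #|{: {ffun 'I_n -> 'I_4} * 'S_n * {ffun 'I_n -> 'I_4}}|%:R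
      * ((\sum_i norm2sq (M i)) / #|E|%:R).
  move=> g_bij; have [K_gt0 _] := card_gt0 _ _ _ g_bij.
  rewrite /dev exchange_big /= mulr_suml mulr_sumr; apply: ler_sum => i _.
  under eq_bigr do rewrite decoupling_errorE // conj_isometry_trace //.
  (* The trace term of [decoupling_errorE] cancels the trace term in [random_unitary_average]. *)
  rewrite sumrB sumr_const -[X in _ - X]mulr_natl lerBlDr -mulrDr.
  exact: random_unitary_average.
have [_ E1_gt0] := card_gt0 _ _ _ g1_bij; have [_ E2_gt0] := card_gt0 _ _ _ g2_bij.
pose b1 := (\sum_i norm2sq (M1 i)) / #|E1|%:R.
pose b2 := (\sum_i norm2sq (M2 i)) / #|E2|%:R.
have b1_gt0 : 0 < b1 by rewrite divr_gt0 // ltr0n.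
have b2_gt0 : 0 < b2 by rewrite divr_gt0 // ltr0n.
have [t|||t le2] := @exists_le_average _ ([ffun=> ord0], 1%g, [ffun=> ord0])
    (fun t => dev _ _ _ g1 M1 t / b1 + dev _ _ _ g2 M2 t / b2) 2%:R.
- by apply/ger0_real/addr_ge0; apply: mulr_ge0; rewrite ?invr_ge0 // ltW.
- by apply/ger0_real/ler0n.
- rewrite big_split /= -!mulr_suml mulr_natr mulr2n.
  by apply: lerD; rewrite ler_pdivrMr //; apply: dev_avg.
have [le1 le1'] : dev _ _ _ g1 M1 t / b1 <= 2%:R /\ dev _ _ _ g2 M2 t / b2 <= 2%:R.
  split; apply: le_trans le2; rewrite ?lerDl ?lerDr;
    by apply: mulr_ge0; rewrite ?invr_ge0 // ltW.
exists (U t); split=> //.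
  by move: le1; rewrite ler_pdivrMr // mulrA.
by move: le1'; rewrite ler_pdivrMr // mulrA.
Qed.

End DecouplingExists.

(** * Kets and operators on tensor products *)

Section Kets.
Variable F : numClosedFieldType.
Implicit Types X Y Z P Q S : finType.

Definition coef X (u : ket F X) (x : X) : F := u (enum_rank x) 0.

Lemma ket_ext X (u v : ket F X) : coef u =1 coef v -> u = v.
Proof.
by move=> uv; apply/colP => i; have := uv (enum_val i); rewrite /coef enum_valK.
Qed.

Lemma op_ext X Y (M N : op F X Y) :
  (forall y x, entry M y x = entry N y x) -> M = N.
Proof.
move=> MN; apply/matrixP => i j.
by have := MN (enum_val i) (enum_val j); rewrite /entry !enum_valK.
Qed.

Lemma sum_enum_rank X (f : 'I_#|X| -> F) : \sum_i f i = \sum_x f (enum_rank x).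
Proof. by rewrite (reindex enum_rank) //; exact/onW_bij/enum_rank_bij. Qed.

Lemma entry_mul X Y Z (M : op F Y Z) (N : op F X Y) z x :
  entry (M *m N) z x = \sum_y entry M z y * entry N y x.
Proof. by rewrite /entry mxE sum_enum_rank. Qed.

Lemma coef_mul X Y (M : op F X Y) (u : ket F X) y :
  coef (M *m u) y = \sum_x entry M y x * coef u x.
Proof. by rewrite /coef mxE sum_enum_rank. Qed.

Lemma entry_adj X Y (M : op F X Y) x y : entry (M ^t* : op F Y X) x y = (entry M y x)^*.
Proof. by rewrite /entry adjE. Qed.

Lemma entry_mkop X Y (f : Y -> X -> F) y x : entry (mkop f : op F X Y) y x = f y x.
Proof. by rewrite /entry mxE !enum_rankK. Qed.

Lemma entry_id X (x x' : X) : entry (idop F X) x x' = (x == x')%:R.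
Proof. by rewrite /entry mxE (inj_eq enum_rank_inj). Qed.

Lemma entry_tens X X' Y Y' (V : op F X X') (W : op F Y Y') p q :
  entry (tens V W) p q = entry V p.1 q.1 * entry W p.2 q.2.
Proof. exact: entry_mkop. Qed.

Lemma coef_tensv X Y (u : ket F X) (v : ket F Y) p :
  coef (tensv u v) p = coef u p.1 * coef v p.2.
Proof. by rewrite /coef mxE enum_rankK. Qed.

Lemma entry_proj X (u : ket F X) x x' : entry (proj u) x x' = coef u x * (coef u x')^*.
Proof. by rewrite /entry /proj mxE big_ord1 adjE. Qed.

Lemma coef_wire X Y (f : Y -> X) (u : ket F X) y :
  coef (wire F f *m u) y = coef u (f y).
Proof.
rewrite coef_mul (bigD1 (f y)) //= entry_mkop eqxx mul1r big1 ?addr0 // => x neq_x.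
by rewrite entry_mkop (negPf neq_x) mul0r.
Qed.

Lemma norm2sq_coef X (u : ket F X) : norm2sq u = \sum_x `|coef u x| ^+ 2.
Proof. by rewrite norm2sqE sum_enum_rank; apply: eq_bigr => x _; rewrite big_ord1. Qed.

Lemma norm2sq_entry X Y (M : op F X Y) :
  norm2sq M = \sum_y \sum_x `|entry M y x| ^+ 2.
Proof.
by rewrite norm2sqE sum_enum_rank; apply: eq_bigr => x _; rewrite sum_enum_rank.
Qed.

Lemma trace_entry X (M : op F X X) : \tr M = \sum_x entry M x x.
Proof. by rewrite /mxtrace sum_enum_rank. Qed.

Lemma conj_by_proj X Y (T : op F X Y) (u : ket F X) :
  conj_by T (proj u) = proj (T *m u).
Proof. by rewrite /conj_by /proj adjM !mulmxA. Qed.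

Lemma conj_byB X Y (T : op F X Y) (M N : op F X X) :
  conj_by T (M - N) = conj_by T M - conj_by T N.
Proof. by rewrite /conj_by mulmxBr mulmxBl. Qed.

Lemma tens_proj X Y (u : ket F X) (v : ket F Y) :
  tens (proj u) (proj v) = proj (tensv u v).
Proof.
apply: op_ext => p q; rewrite entry_tens !entry_proj !coef_tensv rmorphM /=; ring.
Qed.

Lemma tens_adj X X' Y Y' (V : op F X X') (W : op F Y Y') :
  (tens V W) ^t* = tens (V ^t* : op F X' X) (W ^t* : op F Y' Y).
Proof.
apply: op_ext => p q.
by rewrite entry_adj !entry_tens !entry_adj rmorphM.
Qed.

Lemma tens_mul X X' X'' Y Y' Y'' (V : op F X X') (V' : op F X' X'')
    (W : op F Y Y') (W' : op F Y' Y'') :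
  tens V' W' *m tens V W = tens (V' *m V : op F X X'') (W' *m W : op F Y Y'').
Proof.
apply: op_ext => p q; rewrite entry_mul !entry_tens !entry_mul big_distrlr pair_big /=.
by apply: eq_bigr => -[x y] _; rewrite !entry_tens /=; ring.
Qed.

Lemma tens_id X Y : tens (idop F X) (idop F Y) = 1%:M.
Proof.
rewrite -[RHS]/(idop F (X * Y)%type); apply: op_ext => p q.
by rewrite entry_tens !entry_id -natrM mulnb -pair_eqE.
Qed.

Lemma isometry_tens X X' Y Y' (V : op F X X') (W : op F Y Y') :
  isometry_op V -> isometry_op W -> isometry_op (tens V W).
Proof. by move=> VV WW; rewrite /isometry_op tens_adj tens_mul VV WW tens_id. Qed.

Lemma isometry_idop X : isometry_op (idop F X).
Proof. by rewrite /isometry_op adj1 mulmx1. Qed.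

Lemma isometry_wire X Y (f : Y -> X) : bijective f -> isometry_op (wire F f).
Proof.
case=> f' fK f'K; rewrite /isometry_op -[RHS]/(idop F X); apply: op_ext => x x'.
rewrite entry_mul entry_id (bigD1 (f' x)) //= big1 => [|y neq_y].
  by rewrite addr0 entry_adj !entry_mkop f'K eqxx conjC1 mul1r eq_sym.
rewrite entry_adj !entry_mkop (_ : (x == f y) = false) ?conjC0 ?mul0r //.
by apply: contra_neqF neq_y => /eqP ->; rewrite fK.
Qed.

(** In this form an operator on [P] acts by left multiplication, and the Gram matrix is the
    transpose of the reduced state on [S]. *)
Definition ket_mx P S (u : ket F (P * S)%type) : op F S P :=
  mkop (fun p s => coef u (p, s)).

Lemma ket_mx_tens P Q S (W : op F P Q) (u : ket F (P * S)%type) :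
  ket_mx (tens W (idop F S) *m u) = W *m ket_mx u.
Proof.
apply: op_ext => q s; rewrite entry_mkop coef_mul entry_mul.
rewrite sum_pair.
apply: eq_bigr => p _; rewrite (bigD1 s) //= big1 => [|s' neq_s].
  by rewrite addr0 entry_tens entry_id entry_mkop eqxx mulr1.
by rewrite entry_tens entry_id /= eq_sym (negPf neq_s) mulr0 mul0r.
Qed.

Lemma ket_mx_trace P S (u v : ket F (P * S)%type) :
  \tr (u ^t* *m v) = \tr ((ket_mx u) ^t* *m ket_mx v).
Proof.
rewrite trace_mx11 mxE sum_enum_rank trace_entry.
under [RHS]eq_bigr do rewrite entry_mul.
rewrite exchange_big pair_big; apply: eq_bigr => -[p s] _ /=.
by rewrite entry_adj !entry_mkop adjE.
Qed.

(** The isometry from [Uhlmann_mx] makes the overlap real, as [trnorm_pure_le] requires. *)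
Lemma Uhlmann_ket P Q S (u : ket F (P * S)%type) (v : ket F (Q * S)%type) :
  (#|P| <= #|Q|)%N -> norm2sq u = 1 -> norm2sq v = 1 ->
  exists W : op F P Q, isometry_op W /\
    trnorm (proj (tens W (idop F S) *m u) - proj v)
    <= 2%:R * sqrtC (trnorm ((ket_mx u) ^t* *m ket_mx u - (ket_mx v) ^t* *m ket_mx v)).
Proof.
move=> le_PQ u1 v1.
have u1' : norm2sq (ket_mx u) = 1 by rewrite -u1 /norm2sq -ket_mx_trace.
have v1' : norm2sq (ket_mx v) = 1 by rewrite -v1 /norm2sq -ket_mx_trace.
have [W [WW [c_ge0 le_c]]] := Uhlmann_mx le_PQ u1' v1'; exists W; split=> //.
rewrite -(ket_mx_tens W u) -ket_mx_trace in c_ge0 le_c.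
have Wu1 : norm2sq (tens W (idop F S) *m u) = 1.
  by rewrite norm2sq_isometry //; apply: isometry_tens => //; exact: isometry_idop.
apply: le_trans (trnorm_pure_le Wu1 v1 (ger0_real c_ge0)) _.
rewrite ler_wpM2l ?ler0n // ler_sqrtC ?qualifE /= ?trnorm_ge0 //.
rewrite subr_ge0 -[X in X ^+ 2]ger0_norm //.
by apply: le_trans (mxtrace_CauchySchwarz _ _) _; rewrite Wu1 v1 mulr1.
Qed.

(** [chi] is the reference state after [U], [ups] the reference state with an entangled pair
    adjoined. Everything is stated by coefficients, so that the lemma yields W and, with A and B
    exchanged, V. *)
Lemma merging_isometry (C K K' E1 E2 A B R : finType)
    (g : K * (E1 * E2) -> 'I_#|C|) (U : op F C C)
    (f : C -> A -> B -> R -> F) (Phi : K -> K' -> F) (eps : F)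
    (chi : ket F (E1 * E2 * A * (K * B * R))%type)
    (ups : ket F (K' * C * A * (K * B * R))%type)
    (rho : (B * R) * (B * R) -> 'M[F]_#|C|) :
  #|K'| = #|K| -> bijective g -> U ^t* *m U = 1%:M ->
  (forall k l, \sum_k' Phi k k' * (Phi l k')^* = (k == l)%:R / #|K|%:R) ->
  (forall e1 e2 a k b r, coef chi ((e1, e2, a), (k, b, r))
     = \sum_c U (g (k, (e1, e2))) (enum_rank c) * f c a b r) ->
  (forall k' c a k b r, coef ups ((k', c, a), (k, b, r)) = Phi k k' * f c a b r) ->
  (forall b r b' r' c c', rho ((b, r), (b', r')) (enum_rank c) (enum_rank c')
     = \sum_a f c a b r * (f c' a b' r')^*) ->
  norm2sq chi = 1 -> norm2sq ups = 1 ->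
  \sum_p decoupling_error g (U *m rho p *m U ^t*) <= eps ->
  exists W : op F (E1 * E2 * A)%type (K' * C * A)%type, isometry_op W /\
    trnorm (proj (tens W (idop F (K * B * R)%type) *m chi) - proj ups)
    <= 2%:R * 4.-root (#|{: K * B * R}|%:R * eps).
Proof.
move=> cardK' g_bij UU Phi_me chiE upsE rhoE chi1 ups1 le_eps.
have cardC : #|C| = (#|K| * (#|E1| * #|E2|))%N.
  by rewrite -[LHS]card_ord -(bij_eq_card g_bij) !card_prod.
have card_le : (#|{: E1 * E2 * A}| <= #|{: K' * C * A}|)%N.
  rewrite !card_prod leq_mul // cardC cardK' mulnA.
  have [/eqP K0|] := boolP (#|K| == 0)%N; last first.
    by rewrite -lt0n => K_gt0; apply: leq_pmull; rewrite muln_gt0 K_gt0.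
  (* If [K] were empty, [chi] would be the zero ket. *)
  suff : (norm2sq chi == 0) by rewrite chi1 oner_eq0.
  rewrite norm2sq_coef big1 // => -[p [[k b] r]] _.
  by have := enum_rank k; rewrite K0 => -[].
have [W [WW le_W]] := Uhlmann_ket card_le chi1 ups1; exists W; split=> //.
apply: le_trans le_W _; rewrite ler_wpM2l ?ler0n //.
set X := ket_mx chi; set Y := ket_mx ups.
have XE k b r k' b' r' : entry (X ^t* *m X : op F _ _) (k', b', r') (k, b, r)
    = \sum_e (U *m rho ((b, r), (b', r')) *m U ^t*) (g (k, e)) (g (k', e)).
  rewrite entry_mul sum_pair.
  apply: eq_bigr => -[e1 e2] _.
  rewrite mxE sum_enum_rank.
  under [RHS]eq_bigr => c' _.
    rewrite mxE sum_enum_rank mulr_suml.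
    under eq_bigr => c _.
      rewrite rhoE mulr_sumr mulr_suml.
      over.
    over.
  under [LHS]eq_bigr => a _.
    rewrite entry_adj !entry_mkop !chiE rmorph_sum big_distrlr /=.
    over.
  rewrite exchange_big; apply: eq_bigr => c' _; rewrite exchange_big.
  apply: eq_bigr => c _; apply: eq_bigr => a _.
  by rewrite adjE rmorphM /=; ring.
(* The pair contributes the maximally mixed state on [K]. The trace is written with [U], which
   preserves it, to match [decoupling_error]. *)
have YE k b r k' b' r' : entry (Y ^t* *m Y : op F _ _) (k', b', r') (k, b, r)
    = (k == k')%:R * (\tr (U *m rho ((b, r), (b', r')) *m U ^t*) / #|K|%:R).
  rewrite conj_isometry_trace // mulrA [_%:R * \tr _]mulrC -mulrA -Phi_me.
  rewrite entry_mul trace_entry big_distrlr /=.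
  under [RHS]eq_bigr => c _.
    under eq_bigr => k2 _.
      rewrite /entry rhoE mulr_suml.
      over.
    over.
  rewrite !sum_pair.
  rewrite exchange_big; apply: eq_bigr => c _; apply: eq_bigr => k2 _.
  apply: eq_bigr => a _.
  by rewrite entry_adj !entry_mkop !upsE rmorphM /=; ring.
set t := trnorm _.
have t_ge0 : 0 <= t by exact: trnorm_ge0.
(* The squared Hilbert-Schmidt norm of the difference of marginals is exactly the sum of the
   decoupling errors, once the labels are regrouped as K and (B, R). *)
have t2_le : t ^+ 2 <= #|{: K * B * R}|%:R * eps.
  apply: le_trans (trnorm_le_norm2 _) _; rewrite ler_wpM2l ?ler0n //.
  apply: le_trans le_eps; rewrite le_eqVlt; apply/orP; left; apply/eqP.
  rewrite (norm2sq_entry (X ^t* *m X - Y ^t* *m Y : op F _ _)).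
  rewrite exchange_big /=.
  transitivity (\sum_(p : K * (B * R)) \sum_(q : K * (B * R))
     `|\sum_e (U *m rho (p.2, q.2) *m U ^t*) (g (p.1, e)) (g (q.1, e))
       - (p.1 == q.1)%:R * (\tr (U *m rho (p.2, q.2) *m U ^t*) / #|K|%:R)| ^+ 2).
    pose h (p : K * (B * R)) : K * B * R := (p.1, p.2.1, p.2.2).
    have h_bij : bijective h.
      by exists (fun q => (q.1.1, (q.1.2, q.2))) => [[? []]|[[]]].
    rewrite (reindex h); last exact: onW_bij.
    apply: eq_bigr => -[k [b r]] _; rewrite (reindex h); last exact: onW_bij.
    apply: eq_bigr => -[k' [b' r']] _ /=; congr (`|_| ^+ 2).
    by rewrite /h /= -XE -YE /entry !mxE.
  rewrite [LHS]sum_pair [RHS]sum_pair exchange_big; apply: eq_bigr => p _ /=.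
  under eq_bigr do rewrite sum_pair.
  by rewrite [RHS]exchange_big; apply: eq_bigr => k _; rewrite exchange_big.
rewrite -(@ler_pXn2r _ 4) ?qualifE /= ?sqrtC_ge0 ?rootC_ge0 //; last first.
  by apply: le_trans t2_le; apply: exprn_ge0.
by rewrite rootCK // (exprM _ 2 2) sqrtCK.
Qed.

End Kets.

Section Redistribution.
Variable F : numClosedFieldType.
Implicit Types A B C P R S X Y Z : finType.

(** Adjoining a fixed ket as an operator; for a unit ket it is an isometry, to which
    [trnorm_proj_transfer] applies. *)
Definition tens_ket X Y (u : ket F Y) : op F X (Y * X)%type :=
  mkop (fun p x => coef u p.1 * (p.2 == x)%:R).

Lemma tens_ketE X Y (u : ket F Y) (v : ket F X) : tens_ket X u *m v = tensv u v.
Proof.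
apply: ket_ext => -[y x]; rewrite coef_mul coef_tensv (bigD1 x) //= big1 => [|x' neq_x].
  by rewrite entry_mkop eqxx mulr1 addr0.
by rewrite entry_mkop /= eq_sym (negPf neq_x) mulr0 mul0r.
Qed.

Lemma isometry_tens_ket X Y (u : ket F Y) : norm2sq u = 1 -> isometry_op (tens_ket X u).
Proof.
move=> u1; rewrite /isometry_op -[RHS]/(idop F X); apply: op_ext => x x'.
transitivity (norm2sq u * (x == x')%:R); last by rewrite u1 mul1r entry_id.
rewrite entry_mul sum_pair norm2sq_coef mulr_suml.
apply: eq_bigr => y _; rewrite (bigD1 x) //= big1 => [|x'' neq_x].
  by rewrite entry_adj !entry_mkop /= eqxx mulr1 addr0 mulrA normCKC.
by rewrite entry_adj !entry_mkop /= (negPf neq_x) mulr0 conjC0 mul0r.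
Qed.

Lemma trnorm_proj_isometry X Y (J : op F X Y) (u v : ket F X) : isometry_op J ->
  trnorm (proj (J *m u) - proj (J *m v)) <= trnorm (proj u - proj v).
Proof.
move=> JJ; rewrite -!conj_by_proj -conj_byB.
exact/trnorm_conj/isometry_contraction.
Qed.

(** The distance from [u] to [v] is paid once through [J] and once through [G]. *)
Lemma trnorm_proj_transfer X Y (J G : op F X Y) (u v : ket F X) :
  isometry_op J -> isometry_op G ->
  trnorm (proj (J *m u) - proj (G *m u))
  <= 2%:R * trnorm (proj u - proj v) + trnorm (proj (J *m v) - proj (G *m v)).
Proof.
move=> JJ GG.
have -> : proj (J *m u) - proj (G *m u) = (proj (J *m u) - proj (J *m v))
    + ((proj (G *m v) - proj (G *m u)) + (proj (J *m v) - proj (G *m v))).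
  by rewrite [X in _ = _ + X]addrC !addrA !subrK.
apply: le_trans (trnorm_triangle _ _) _; rewrite mulr_natl mulr2n -[leRHS]addrA.
apply: lerD; first exact: trnorm_proj_isometry.
apply: le_trans (trnorm_triangle _ _) _; apply: lerD => //.
by rewrite -opprB trnormN; exact: trnorm_proj_isometry.
Qed.

Lemma max_entangled_marginal X Y (Phi : ket F (X * Y)%type) : max_entangled Phi ->
  forall x x', \sum_y coef Phi (x, y) * (coef Phi (x', y))^* = (x == x')%:R / #|X|%:R.
Proof.
move=> [e [f [[e1 e0] [f1 f0] ->]]] x x'.
pose E : op F X X := mkop (fun x i => coef (e i) x).
have braketE Z (u v : ket F Z) : braket u v = \sum_z (coef u z)^* * coef v z.
  rewrite /braket trace_mx11 mxE sum_enum_rank; apply: eq_bigr => z _.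
  by rewrite adjE.
have EE : E ^t* *m E = 1%:M.
  rewrite -[RHS]/(idop F X); apply: op_ext => i j; rewrite entry_mul entry_id.
  under eq_bigr do rewrite entry_adj !entry_mkop.
  rewrite -braketE; case: eqVneq => [<-|/eqP/e0 //]; exact: e1.
(* [E] is square, so its orthonormal columns give orthonormal rows, the completeness relation. *)
have ee : \sum_i coef (e i) x * (coef (e i) x')^* = (x == x')%:R.
  have := mulmx1C EE => /(congr1 (fun M : op F X X => entry M x x')).
  rewrite -[in RHS]/(idop F X) entry_id => <-; rewrite entry_mul.
  by apply: eq_bigr => i _; rewrite entry_adj !entry_mkop.
have ff i j : \sum_y coef (f i) y * (coef (f j) y)^* = (i == j)%:R.
  transitivity (braket (f j) (f i)).
    by rewrite braketE; apply: eq_bigr => y _; rewrite mulrC.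
  by rewrite eq_sym; case: eqVneq => [->|/eqP/f0 //]; exact: f1.
have coefE z y : coef ((sqrtC #|X|%:R)^-1 *: \sum_i tensv (e i) (f i)) (z, y)
    = (sqrtC #|X|%:R)^-1 * \sum_i coef (e i) z * coef (f i) y.
  rewrite {1}/coef mxE summxE; congr (_ * _); apply: eq_bigr => i _.
  exact: coef_tensv.
have sqn : (sqrtC #|X|%:R)^-1 * ((sqrtC #|X|%:R)^-1)^* = #|X|%:R^-1 :> F.
  rewrite -normCK ger0_norm ?invr_ge0 ?sqrtC_ge0 ?ler0n //.
  by rewrite exprVn sqrtCK.
under eq_bigr => y _ do rewrite !coefE rmorphM /= mulrACA sqn.
rewrite -mulr_sumr mulrC -ee; congr (_ * _).
under eq_bigr do rewrite rmorph_sum big_distrlr /=.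
rewrite exchange_big; apply: eq_bigr => i _ /=.
rewrite exchange_big (bigD1 i) //= [X in _ + X]big1 ?addr0 => [|j neq_j].
  under eq_bigr do rewrite rmorphM /= mulrACA.
  by rewrite -mulr_sumr ff eqxx mulr1.
under eq_bigr do rewrite rmorphM /= mulrACA.
by rewrite -mulr_sumr ff eq_sym (negPf neq_j) mulr0.
Qed.

Lemma max_entangled_norm X Y (Phi : ket F (X * Y)%type) :
  (0 < #|X|)%N -> max_entangled Phi -> norm2sq Phi = 1.
Proof.
move=> X_gt0 /max_entangled_marginal PhiE; rewrite norm2sq_coef sum_pair.
under eq_bigr => x _.
  under eq_bigr do rewrite normCK.
  rewrite PhiE eqxx mul1r.
  over.
by rewrite sumr_const -[_ *+ _]mulr_natl mulfV // pnatr_eq0 -lt0n.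
Qed.

Lemma coef_tens_id_mid P Y Y' R (V : op F Y Y') (u : ket F (P * Y * R)%type) p y' r :
  coef (tens (tens (idop F P) V) (idop F R) *m u) (p, y', r)
  = \sum_y entry V y' y * coef u (p, y, r).
Proof.
rewrite coef_mul !sum_pair (bigD1 p) //= [X in _ + X]big1 ?addr0 => [|p' neq_p].
  apply: eq_bigr => y _; rewrite (bigD1 r) //= big1 ?addr0 => [|r' neq_r].
    by rewrite !entry_tens !entry_id /= !eqxx mul1r mulr1.
  by rewrite !entry_tens !entry_id /= [r == _]eq_sym (negPf neq_r) mulr0 mul0r.
rewrite big1 // => y _; rewrite big1 // => r' _.
by rewrite !entry_tens !entry_id /= [p == _]eq_sym (negPf neq_p) !mul0r.
Qed.

Lemma coef_tens_id_r P Y Y' (V : op F Y Y') (u : ket F (Y * P)%type) y' p :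
  coef (tens V (idop F P) *m u) (y', p) = \sum_y entry V y' y * coef u (y, p).
Proof.
rewrite coef_mul sum_pair; apply: eq_bigr => y _.
rewrite (bigD1 p) //= big1 ?addr0 => [|p' neq_p].
  by rewrite entry_tens entry_id eqxx mulr1.
by rewrite entry_tens entry_id /= eq_sym (negPf neq_p) mulr0 mul0r.
Qed.

(** Cuts an operator on C B R into operators on C, on which [U] acts block by block. *)
Definition blocks C B R (M : op F (C * B * R)%type (C * B * R)%type)
    (p : (B * R) * (B * R)) : op F C C :=
  mkop (fun c c' => entry M (c, p.1.1, p.1.2) (c', p.2.1, p.2.2)).

Lemma norm2sq_blocks C B R (M : op F (C * B * R)%type (C * B * R)%type) :
  \sum_p norm2sq (blocks M p) = norm2sq M.
Proof.
have sum3 (h : C * B * R -> F) :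
    \sum_q h q = \sum_(x : B * R) \sum_c h (c, x.1, x.2).
  rewrite !sum_pair exchange_big; apply: eq_bigr => b _ /=.
  by rewrite exchange_big.
rewrite norm2sq_entry sum_pair sum3; apply: eq_bigr => x _ /=.
under [RHS]eq_bigr do rewrite sum3.
rewrite [RHS]exchange_big; apply: eq_bigr => y _ /=.
rewrite norm2sq_entry; apply: eq_bigr => c _; apply: eq_bigr => c' _.
by rewrite entry_mkop.
Qed.

Lemma entry_reduced_CBR C A B R (phi : ket F (C * A * B * R)%type) c b r c' b' r' :
  entry (reduced_CBR phi) (c, b, r) (c', b', r')
  = \sum_a coef phi (c, a, b, r) * (coef phi (c', a, b', r'))^*.
Proof.
rewrite entry_mkop; apply: eq_bigr => a _.
by rewrite conj_by_proj entry_proj !coef_wire.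
Qed.

Lemma entry_reduced_CAR C A B R (phi : ket F (C * A * B * R)%type) c a r c' a' r' :
  entry (reduced_CAR phi) (c, a, r) (c', a', r')
  = \sum_b coef phi (c, a, b, r) * (coef phi (c', a', b, r'))^*.
Proof.
rewrite entry_mkop; apply: eq_bigr => b _.
by rewrite conj_by_proj entry_proj !coef_wire.
Qed.

(** Hermiticity turns the purity tr(M^2) into [norm2sq M]; the trace shows that [M] is nonzero. *)
Lemma ptrace2_proj_purity X Y (u : ket F (X * Y)%type) :
  let M := ptrace2 (proj u) in
  M ^t* = M /\ \tr M = norm2sq u.
Proof.
split.
  apply: op_ext => x x'; rewrite entry_adj !entry_mkop rmorph_sum.
  by apply: eq_bigr => y _; rewrite !entry_proj rmorphM /= conjCK mulrC.
rewrite trace_entry norm2sq_coef sum_pair; apply: eq_bigr => x _.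
by rewrite entry_mkop; apply: eq_bigr => y _; rewrite entry_proj -normCK.
Qed.

End Redistribution.

(** * State redistribution *)

Section Main.
Variable F : numClosedFieldType.

(** Here [T] is V o W^-1 or its reverse, which carries one pivot ket [u] exactly to the other, [w];
    being a contraction, it does not enlarge the distance from [u] to [v]. *)
Lemma conj_by_triangle (X Y : finType) (T : op F X Y) (u v : ket F X) (w : ket F Y)
    (d1 d2 : F) : contraction T -> T *m u = w ->
  forall w', trnorm (proj u - proj v) <= d1 -> trnorm (proj w - proj w') <= d2 ->
  trnorm (conj_by T (proj v) - proj w') <= d1 + d2.
Proof.
move=> hT <- w' le1 le2.
have -> : conj_by T (proj v) - proj w'
    = conj_by T (proj v - proj u) + (proj (T *m u) - proj w').
  by rewrite conj_byB (conj_by_proj T u) [RHS]addrA subrK.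
apply: le_trans (trnorm_triangle _ _) _; apply: lerD le2.
apply: le_trans (trnorm_conj _ hT) _.
by rewrite -opprB trnormN.
Qed.

Lemma reduced_CBR_purity (C A B R : finType) (phi : ket F (C * A * B * R)%type) :
  let M := reduced_CBR phi in
  \tr (M *m M) = norm2sq M /\ \tr M = norm2sq phi.
Proof.
rewrite /reduced_CBR conj_by_proj; set u := (X in proj X).
have [Madj trM] := ptrace2_proj_purity u; rewrite /norm2sq Madj trM; split=> //.
apply: norm2sq_isometry; apply: isometry_wire.
exists (fun p => let: (c, a, b, r) := p in (c, b, r, a)) => -[[[? ?] ?] ?] //.
Qed.

Lemma reduced_CAR_purity (C A B R : finType) (phi : ket F (C * A * B * R)%type) :
  let M := reduced_CAR phi in
  \tr (M *m M) = norm2sq M /\ \tr M = norm2sq phi.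
Proof.
rewrite /reduced_CAR conj_by_proj; set u := (X in proj X).
have [Madj trM] := ptrace2_proj_purity u; rewrite /norm2sq Madj trM; split=> //.
apply: norm2sq_isometry; apply: isometry_wire.
exists (fun p => let: (c, a, b, r) := p in (c, a, r, b)) => -[[[? ?] ?] ?] //.
Qed.

Lemma redistribution (A B R C1 C2 C3 A2 B1 : finType)
    (C := (C1 * C2 * C3)%type : finType)
    (Phi2 : ket F (C2 * A2)%type) (Phi1 : ket F (C1 * B1)%type)
    (phi phihat phicheck : ket F (C * A * B * R)%type) :
  #|A2| = #|C2| -> #|B1| = #|C1| -> max_entangled Phi2 -> max_entangled Phi1 ->
  pure phi -> pure phihat -> pure phicheck ->
  let gamma1 := 2%:R * trnorm (proj phi - proj phihat) in
  let gamma2 := 2%:R * trnorm (proj phi - proj phicheck) in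
  let eta1 := 2%:R * 4.-root
    (2%:R * #|C|%:R * #|{: B * R}|%:R
       * \tr (reduced_CBR phihat *m reduced_CBR phihat)
       / #|{: C1 * C3}|%:R ^+ 2) in
  let eta2 := 2%:R * 4.-root
    (2%:R * #|C|%:R * #|{: A * R}|%:R
       * \tr (reduced_CAR phicheck *m reduced_CAR phicheck)
       / #|{: C2 * C3}|%:R ^+ 2) in
  let Delta1 := gamma1 + eta1 in
  let Delta2 := gamma2 + eta2 in
  exists (V : op F (C2 * C3 * B)%type (B1 * C * B)%type)
         (W : op F (C1 * C3 * A)%type (A2 * C * A)%type),
    [/\ isometry_op V, isometry_op W,
        trnorm (conj_by (V_Winv R V W) (Upsilon_initial Phi2 phi)
                - Upsilon_final Phi1 phi) <= Delta1 + Delta2 &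
        trnorm (conj_by (W_Vinv R V W) (Upsilon_final Phi1 phi)
                - Upsilon_initial Phi2 phi) <= Delta1 + Delta2].
Proof.
move=> cardA2 cardB1 Phi2_me Phi1_me phi1 hat1 check1.
move=> gamma1 gamma2 eta1 eta2 Delta1 Delta2.
change (norm2sq phi = 1) in phi1; change (norm2sq phihat = 1) in hat1.
change (norm2sq phicheck = 1) in check1.
(* A unit ket is nonzero, so every system has a basis label. *)
have [p _] : {p : C * A * B * R | true}.
  case: (pickP (fun _ : C * A * B * R => true)) => [p|none]; first by exists p.
  have /eqP := hat1; rewrite norm2sq_coef big1 => [|p]; last by have := none p.
  by rewrite eq_sym oner_eq0.
have C1_gt0 : (0 < #|C1|)%N by apply/card_gt0P; exists p.1.1.1.1.1.
have C2_gt0 : (0 < #|C2|)%N by apply/card_gt0P; exists p.1.1.1.1.2.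
have C3_gt0 : (0 < #|C3|)%N by apply/card_gt0P; exists p.1.1.1.2.
have cardC : #|C| = (#|C1| * #|C2| * #|C3|)%N by rewrite !card_prod.
have C_gt0 : (0 < #|C|)%N by rewrite cardC !muln_gt0 C1_gt0 C2_gt0 C3_gt0.
(* For W the kept factor is C2 and C1 C3 is traced out; for V the kept factor is C1 and C2 C3 is
   traced out. *)
pose g1 (q : C2 * (C1 * C3)) : 'I_#|C| := enum_rank (q.2.1, q.1, q.2.2).
pose g2 (q : C1 * (C2 * C3)) : 'I_#|C| := enum_rank (q.1, q.2.1, q.2.2).
have g1_bij : bijective g1.
  apply: (bij_comp (@enum_rank_bij C) (h := fun q => (q.2.1, q.1, q.2.2))).
  by exists (fun c : C => (c.1.2, (c.1.1, c.2))) => [[? []]|[[]]].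
have g2_bij : bijective g2.
  apply: (bij_comp (@enum_rank_bij C) (h := fun q => (q.1, q.2.1, q.2.2))).
  by exists (fun c : C => (c.1.1, (c.1.2, c.2))) => [[? []]|[[]]].
have [purity1 tr1] := reduced_CBR_purity phihat.
have [purity2 tr2] := reduced_CAR_purity phicheck.
set M1 := reduced_CBR phihat in purity1 tr1.
set M2 := reduced_CAR phicheck in purity2 tr2.
have M1_gt0 : 0 < norm2sq M1 by apply: norm2sq_gt0; rewrite tr1.
have M2_gt0 : 0 < norm2sq M2 by apply: norm2sq_gt0; rewrite tr2.
have [|| U [UU err1 err2]] := @decoupling_exists F _ _ _ _ _ _ _ g1 g2
  (blocks M1) (blocks M2) C_gt0 g1_bij g2_bij.
- by rewrite norm2sq_blocks.
- by rewrite norm2sq_blocks.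
rewrite !norm2sq_blocks in err1 err2.
(* J1 and J2 apply U on C and regroup the factors for W and for V; G1 and G2
   adjoin the entangled pairs Phi2 and Phi1. *)
pose rotate : op F (C * A * B * R)%type (C * (A * B * R))%type :=
  tens U (idop F (A * B * R)%type)
  *m wire F (fun q : C * (A * B * R) => let: (c, (a, b, r)) := q in (c, a, b, r)).
have rotate_iso : isometry_op rotate.
  apply: isometryM; first by apply: isometry_tens => //; exact: isometry_idop.
  apply: isometry_wire.
  by exists (fun q => let: (c, a, b, r) := q in (c, (a, b, r))) => [[? [[]]]|[[[]]]].
have coef_rotate u c a b r : coef (rotate *m u) (c, (a, b, r))
    = \sum_c' U (enum_rank c) (enum_rank c') * coef u (c', a, b, r).
  rewrite -mulmxA coef_tens_id_r; apply: eq_bigr => c' _; by rewrite coef_wire.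
pose J1 : op F (C * A * B * R)%type (C1 * C3 * A * (C2 * B * R))%type :=
  wire F (fun q : C1 * C3 * A * (C2 * B * R) =>
    let: ((c1, c3, a), (c2, b, r)) := q in ((c1, c2, c3), (a, b, r))) *m rotate.
pose J2 : op F (C * A * B * R)%type (C2 * C3 * B * (C1 * A * R))%type :=
  wire F (fun q : C2 * C3 * B * (C1 * A * R) =>
    let: ((c2, c3, b), (c1, a, r)) := q in ((c1, c2, c3), (a, b, r))) *m rotate.
have J1_iso : isometry_op J1.
  apply: isometryM rotate_iso; apply: isometry_wire.
  by exists (fun q : C * (A * B * R) => let: ((c1, c2, c3), (a, b, r)) := q in
    ((c1, c3, a), (c2, b, r))) => [[[[? ?] ?] [[? ?] ?]]|[[[? ?] ?] [[? ?] ?]]].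
have J2_iso : isometry_op J2.
  apply: isometryM rotate_iso; apply: isometry_wire.
  by exists (fun q : C * (A * B * R) => let: ((c1, c2, c3), (a, b, r)) := q in
    ((c2, c3, b), (c1, a, r))) => [[[[? ?] ?] [[? ?] ?]]|[[[? ?] ?] [[? ?] ?]]].
pose G1 : op F (C * A * B * R)%type (A2 * C * A * (C2 * B * R))%type :=
  wire F (fun q : A2 * C * A * (C2 * B * R) =>
    let: ((a2, c, a), (c2, b, r)) := q in ((c2, a2), (c, a, b, r))) *m tens_ket _ Phi2.
pose G2 : op F (C * A * B * R)%type (B1 * C * B * (C1 * A * R))%type :=
  wire F (fun q : B1 * C * B * (C1 * A * R) =>
    let: ((b1, c, b), (c1, a, r)) := q in ((c1, b1), (c, a, b, r))) *m tens_ket _ Phi1.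
have G1_iso : isometry_op G1.
  apply: isometryM; last exact/isometry_tens_ket/max_entangled_norm.
  apply: isometry_wire.
  by exists (fun q => let: ((c2, a2), (c, a, b, r)) := q in ((a2, c, a), (c2, b, r)))
    => [[[[? ?] ?] [[? ?] ?]]|[[? ?] [[[? ?] ?] ?]]].
have G2_iso : isometry_op G2.
  apply: isometryM; last exact/isometry_tens_ket/max_entangled_norm.
  apply: isometry_wire.
  by exists (fun q => let: ((c1, b1), (c, a, b, r)) := q in ((b1, c, b), (c1, a, r)))
    => [[[[? ?] ?] [[? ?] ?]]|[[? ?] [[[? ?] ?] ?]]].
have [W [W_iso le_W]] : exists W : op F (C1 * C3 * A)%type (A2 * C * A)%type,
    isometry_op W /\
    trnorm (proj (tens W (idop F (C2 * B * R)%type) *m (J1 *m phihat))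
            - proj (G1 *m phihat))
    <= eta1.
  have [||||||W [W_iso le_W]] := @merging_isometry F C C2 A2 C1 C3 A B R g1 U
    (fun c a b r => coef phihat (c, a, b, r)) (fun k k' => coef Phi2 (k, k'))
    (2%:R * norm2sq M1 / #|{: C1 * C3}|%:R) (J1 *m phihat) (G1 *m phihat) (blocks M1)
    cardA2 g1_bij UU (max_entangled_marginal Phi2_me).
  - by move=> e1 e2 a k b r; rewrite -mulmxA coef_wire coef_rotate.
  - by move=> k' c a k b r; rewrite -mulmxA coef_wire tens_ketE coef_tensv.
  - move=> b r b' r' c c'; rewrite -[LHS]/(entry (blocks M1 ((b, r), (b', r'))) c c').
    by rewrite entry_mkop entry_reduced_CBR.
  - by rewrite norm2sq_isometry.
  - by rewrite norm2sq_isometry.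
  - exact: err1.
  exists W; split=> //; apply: le_trans le_W _.
  (* d_{C2} / d_{C1 C3} equals d_C / d_{C1 C3}^2. *)
  rewrite le_eqVlt; apply/orP; left; apply/eqP; congr (_ * 4.-root _).
  rewrite purity1 cardC !card_prod !natrM; field.
  by rewrite !pnatr_eq0 -!lt0n C1_gt0 C3_gt0.
have [V [V_iso le_V]] : exists V : op F (C2 * C3 * B)%type (B1 * C * B)%type,
    isometry_op V /\
    trnorm (proj (tens V (idop F (C1 * A * R)%type) *m (J2 *m phicheck))
            - proj (G2 *m phicheck))
    <= eta2.
  (* The same lemma with A and B, and C1 and C2, exchanged. *)
  have [||||||V [V_iso le_V]] := @merging_isometry F C C1 B1 C2 C3 B A R g2 U
    (fun c b a r => coef phicheck (c, a, b, r)) (fun k k' => coef Phi1 (k, k'))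
    (2%:R * norm2sq M2 / #|{: C2 * C3}|%:R) (J2 *m phicheck) (G2 *m phicheck)
    (blocks M2)
    cardB1 g2_bij UU (max_entangled_marginal Phi1_me).
  - by move=> e1 e2 b k a r; rewrite -mulmxA coef_wire coef_rotate.
  - by move=> k' c b k a r; rewrite -mulmxA coef_wire tens_ketE coef_tensv.
  - move=> a r a' r' c c'; rewrite -[LHS]/(entry (blocks M2 ((a, r), (a', r'))) c c').
    by rewrite entry_mkop entry_reduced_CAR.
  - by rewrite norm2sq_isometry.
  - by rewrite norm2sq_isometry.
  - exact: err2.
  exists V; split=> //; apply: le_trans le_V _.
  rewrite le_eqVlt; apply/orP; left; apply/eqP; congr (_ * 4.-root _).
  rewrite purity2 cardC !card_prod !natrM; field.
  by rewrite !pnatr_eq0 -!lt0n C2_gt0 C3_gt0.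
have WX_iso : isometry_op (tens W (idop F (C2 * B * R)%type)).
  by apply: isometry_tens => //; exact: isometry_idop.
have VX_iso : isometry_op (tens V (idop F (C1 * A * R)%type)).
  by apply: isometry_tens => //; exact: isometry_idop.
have XVX_iso : isometry_op (tens (tens (idop F (C1 * A)%type) V) (idop F R)).
  by apply: isometry_tens; [apply: isometry_tens|]; rewrite //; exact: isometry_idop.
have regroup_iso : isometry_op (regroup F C1 C2 C3 A B R).
  apply: isometry_wire.
  by exists (fun q => let: ((c1, c3, a), (c2, b, r)) := q in ((c1, a), (c2, c3, b), r))
    => [[[[? ?] [[? ?] ?]] ?]|[[[? ?] ?] [[? ?] ?]]].
pose swap : op F (B1 * C * B * (C1 * A * R))%type (C1 * A * (B1 * C * B) * R)%type :=
  wire F (fun q : C1 * A * (B1 * C * B) * R => (q.1.2, (q.1.1, q.2))).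
have swap_iso : isometry_op swap.
  apply: isometry_wire.
  by exists (fun q => (q.2.1, q.1, q.2.2)) => [[[? ?] ?]|[? [? ?]]].
(* The pivots: W and V applied to phi after [U], each in the factor order of the target it
   approximates. V o W^-1 maps [w] to [v] exactly. *)
pose w := tens W (idop F (C2 * B * R)%type) *m (J1 *m phi).
pose v := tens (tens (idop F (C1 * A)%type) V) (idop F R)
  *m (regroup F C1 C2 C3 A B R *m (J1 *m phi)).
have initialE : Upsilon_initial Phi2 phi = proj (G1 *m phi).
  by rewrite /Upsilon_initial tens_proj conj_by_proj -tens_ketE mulmxA.
have finalE : Upsilon_final Phi1 phi = proj (swap *m (G2 *m phi)).
  rewrite /Upsilon_final tens_proj conj_by_proj -tens_ketE /G2 -mulmxA.
  congr proj; apply: ket_ext => -[[[c1 a] [[b1 c] b]] r].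
  by rewrite !coef_wire.
have vE : v = swap *m (tens V (idop F (C1 * A * R)%type) *m (J2 *m phi)).
  apply: ket_ext => -[[[c1 a] x] r].
  rewrite coef_tens_id_mid coef_wire coef_tens_id_r; apply: eq_bigr => -[[c2 c3] b] _.
  by rewrite /J1 /J2 -!mulmxA !coef_wire.
have le_w : trnorm (proj w - proj (G1 *m phi)) <= Delta1.
  rewrite /w mulmxA; apply: le_trans (trnorm_proj_transfer phi phihat _ G1_iso) _.
    exact: isometryM.
  by rewrite lerD2l -mulmxA.
have le_v : trnorm (proj v - proj (swap *m (G2 *m phi))) <= Delta2.
  rewrite vE; apply: le_trans (trnorm_proj_isometry _ _ swap_iso) _.
  rewrite mulmxA; apply: le_trans (trnorm_proj_transfer phi phicheck _ G2_iso) _.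
    exact: isometryM.
  by rewrite lerD2l -mulmxA.
exists V, W; split=> //; rewrite initialE finalE.
  apply: conj_by_triangle le_w le_v.
    apply: contractionM.
      by apply: contractionM; exact: isometry_contraction.
    (* The adjoint of W need not be an isometry, but it is a contraction. *)
    have -> : tens (W ^t*) (idop F (C2 * B * R)%type)
        = (tens W (idop F (C2 * B * R)%type)) ^t* by rewrite tens_adj adj1.
    exact/contraction_adj/isometry_contraction.
  rewrite /V_Winv /w /v -!mulmxA; do 2 congr (_ *m _).
  by rewrite mulmxA tens_mul W_iso mulmx1 tens_id mul1mx.
rewrite [leRHS]addrC; apply: conj_by_triangle le_v le_w.
  apply: contractionM.
    apply: contractionM; first exact: isometry_contraction.
    exact/contraction_adj/isometry_contraction.
  have -> : tens (tens (idop F (C1 * A)%type) (V ^t*)) (idop F R)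
      = (tens (tens (idop F (C1 * A)%type) V) (idop F R)) ^t*.
    by rewrite !tens_adj !adj1.
  exact/contraction_adj/isometry_contraction.
(* The adjoint of V undoes V, and the adjoint of [regroup] undoes the regrouping. *)
rewrite /W_Vinv /w /v -!mulmxA; congr (_ *m _).
rewrite [X in _ *m X]mulmxA !tens_mul V_iso !mulmx1 !tens_id mul1mx.
by rewrite mulmxA regroup_iso mul1mx.
Qed.

End Main.

Theorem theorem3 (K : realType) (A B R C1 C2 C3 A2 B1 : finType)
    (C := (C1 * C2 * C3)%type : finType)
    (dimA2 : #|A2| = #|C2|) (dimB1 : #|B1| = #|C1|)
    (Phi2 : ket K[i] (C2 * A2)%type) (Phi1 : ket K[i] (C1 * B1)%type)
    (Phi2_me : max_entangled Phi2) (Phi1_me : max_entangled Phi1)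
    (phi phihat phicheck : ket K[i] (C * A * B * R)%type)
    (phi_pure : pure phi) (phihat_pure : pure phihat)
    (phicheck_pure : pure phicheck) :
  let gamma1 := 2%:R * trnorm (proj phi - proj phihat) in
  let gamma2 := 2%:R * trnorm (proj phi - proj phicheck) in
  let eta1 := 2%:R * 4.-root
    (2%:R * #|C|%:R * #|{: B * R}|%:R
       * \tr (reduced_CBR phihat *m reduced_CBR phihat)
       / #|{: C1 * C3}|%:R ^+ 2) in
  let eta2 := 2%:R * 4.-root
    (2%:R * #|C|%:R * #|{: A * R}|%:R
       * \tr (reduced_CAR phicheck *m reduced_CAR phicheck)
       / #|{: C2 * C3}|%:R ^+ 2) in
  let Delta1 := gamma1 + eta1 in
  let Delta2 := gamma2 + eta2 in
  exists (V : op K[i] (C2 * C3 * B)%type (B1 * C * B)%type)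
         (W : op K[i] (C1 * C3 * A)%type (A2 * C * A)%type),
    [/\ isometry_op V, isometry_op W,
        trnorm (conj_by (V_Winv R V W) (Upsilon_initial Phi2 phi)
                - Upsilon_final Phi1 phi) <= Delta1 + Delta2 &
        trnorm (conj_by (W_Vinv R V W) (Upsilon_final Phi1 phi)
                - Upsilon_initial Phi2 phi) <= Delta1 + Delta2].
Proof.
exact: (@redistribution K[i] A B R C1 C2 C3 A2 B1 Phi2 Phi1 phi phihat phicheck).
Qed.
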